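(* Let $n \ge 3$ be an odd integer and let $G = C_2^3 \oplus C_{2n}$. Then $$\nu(G) = \nu_2(G) = \mathsf d(G) = \mathsf d^*(G).$$
   Context: All groups are additively written finite abelian groups; $C_m$ denotes a cyclic group of order $m$, and $C_m^r$ the direct sum of $r$ copies of $C_m$. For a finite abelian group $G$ put $G^\bullet = G \setminus \{0\}$. A sequence over $G$ is an element of the free abelian monoid with basis $G$, i.e. a finite unordered list $S = g_1 \cdot \ldots \cdot g_\ell$ of elements of $G$ with repetition allowed; its length is $|S| = \ell$. Its set of subsequence sums is $\Sigma(S) = \{\sum_{i \in I} g_i : \emptyset \ne I \subseteq \{1,\ldots,\ell\}\}$. The sequence $S$ is zero-sum free if $0 \notin \Sigma(S)$. The small Davenport constant $\mathsf d(G)$ is the maximal length of a zero-sum free sequence over $G$. If $G$ is nontrivial and $G \cong C_{n_1} \oplus \ldots \oplus C_{n_r}$ with $1 < n_1 \mid n_2 \mid \ldots \mid n_r$, then $\mathsf d^*(G) = \sum_{i=1}^r (n_i - 1)$. For nontrivial $G$, $\nu(G)$ is the smallest integer $\ell$ such that every zero-sum free sequence $T$ over $G$ with $|T| \ge \ell$ satisfies: there exist a subgroup $H \subsetneq G$ and an element $\alpha \in G \setminus H$ with $G^\bullet \setminus \Sigma(T) \subseteq \alpha + H$. For a prime divisor $p$ of $|G|$, $\nu_p(G)$ is the smallest integer $\ell$ such that every zero-sum free sequence $T$ over $G$ with $|T| \ge \ell$ satisfies: there exist a subgroup $H \subseteq G$ with index $[G:H] = p$ and an element $\alpha \in G \setminus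 H$ with $G^\bullet \setminus \Sigma(T) \subseteq \alpha + H$. In particular $\nu_2(G)$ is the case $p = 2$. *)

(* Defs.v *)
From mathcomp Require Import all_boot all_order all_algebra.
From mathcomp Require Import all_fingroup all_solvable.
From mathcomp Require Import boolp.

Set Implicit Arguments.
Unset Strict Implicit.
Unset Printing Implicit Defensive.

Import GRing.Theory.
Local Open Scope ring_scope.

(* Finite abelian groups are additive: [G : finZmodType].  Such a [G] is also
   a [finGroupType] with [x * y = x + y] and [1 = 0] by conversion, so
   [{group G}] is the type of subgroups of [G].  A sequence over [G] is
   represented by a [seq G]; every notion below is invariant under permutation
   of the terms. *)

Section ZeroSumFree.
Variable G : finZmodType.
Implicit Types (S T : seq G) (H : {group G}).

Definition Sigma S : {set G} :=
  [set \sum_(i in I) S`_i | I : {set 'I_(size S)} & I != set0].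

Definition zero_sum_free S : bool := 0 \notin Sigma S.

Lemma zero_sum_free_nil : zero_sum_free [::].
Proof.
apply/imsetP=> -[I]; rewrite inE => /set0Pn[i _] _; by case: i.
Qed.

Lemma zero_sum_free_size S : zero_sum_free S -> (size S <= #|G|)%N.
Proof.
move=> zfS; pose f (k : 'I_(size S)) : G := \sum_(i < size S | (i < k)%N) S`_i.
suff /leq_card : injective f by rewrite card_ord.
suff f_lt (a b : 'I_(size S)) : (a < b)%N -> f a <> f b.
  move=> a b fab; apply: val_inj => /=.
  by case: (ltngtP a b) => // /f_lt; rewrite fab.
move=> ltab fab; move/negP: zfS; apply.
apply/imsetP; exists [set i : 'I_(size S) | (a <= i < b)%N].
  by rewrite inE; apply/set0Pn; exists a; rewrite inE leqnn.
have : f b = f a + \sum_(i < size S | (a <= i < b)%N) S`_i.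
  rewrite /f (bigID (fun i : 'I_(size S) => (i < a)%N)) /=; congr (_ + _).
    by apply: eq_bigl => i; case: (ltnP i a) => [/ltn_trans->|]; rewrite ?andbF.
  by apply: eq_bigl => i; rewrite -leqNgt andbC.
rewrite -fab -[LHS]addr0 => /addrI sum0; rewrite [LHS]sum0.
by apply: eq_bigl => i; rewrite inE.
Qed.

Definition zero_sum_free_length (l : nat) : bool :=
  [exists T : l.-tuple G, zero_sum_free T].

Lemma zero_sum_free_length_ex : exists l, zero_sum_free_length l.
Proof. by exists 0%N; apply/existsP; exists [tuple]; apply: zero_sum_free_nil. Qed.

Lemma zero_sum_free_length_le l : zero_sum_free_length l -> (l <= #|G|)%N.
Proof. by case/existsP=> T /zero_sum_free_size; rewrite size_tuple. Qed.

Definition davenport : nat :=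
  ex_maxn zero_sum_free_length_ex zero_sum_free_length_le.

(* [abelian_type] lists the invariant factors n_r, ..., n_1 of G (each > 1, and
   each divisible by the next), so the order is reversed. *)
Definition davenport_star : nat :=
  (\sum_(m <- abelian_type [set: G]) (m - 1))%N.

Definition missing_in_coset (P : pred {group G}) (l : nat) : Prop :=
  forall T, zero_sum_free T -> (l <= size T)%N ->
  exists H (a : G),
    [/\ P H, a \notin H
      & [set~ 0] :\: Sigma T \subset [set a + h | h in H]].

Lemma missing_in_coset_ex P : exists l, `[< missing_in_coset P l >].
Proof.
exists #|G|.+1; apply/asboolP => T /zero_sum_free_size leTG.
by rewrite ltnNge leTG.
Qed.

(* [nu] is intended for G nontrivial, and [nu_index p] for p a prime divisor of
   #|G|; outside these cases their values carry no meaning. *)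
Definition nu : nat :=
  ex_minn (missing_in_coset_ex (fun H => H \proper [set: G])).

Definition nu_index (p : nat) : nat :=
  ex_minn (missing_in_coset_ex (fun H => #|[set: G] : H|%g == p)).

End ZeroSumFree.

Arguments davenport G : clear implicits.
Arguments davenport_star G : clear implicits.
Arguments nu G : clear implicits.
Arguments nu_index G p : clear implicits.

(* Main.v *)
Require Import Defs.
From mathcomp Require Import all_boot all_order all_algebra.
From mathcomp Require Import all_fingroup all_solvable.
From mathcomp Require Import boolp zify.

Set Implicit Arguments.
Unset Strict Implicit.
Unset Printing Implicit Defensive.

(** Put C = {x | n x = 0} and V = {x | 2 x = 0}, subgroups of orders n and 16; the
    value of an element x is the element n x of V, and it is 0 exactly on C.

    Upper bound. A zero-sum free sequence over C has at most n - 1 terms, and if it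
    has n - 1 terms then they are all equal ([zero_sum_free_torsion_size],
    [zero_sum_free_torsion_const]). Suppose that a zero-sum free sequence over G
    has 2 n + 3 terms. Merge pairs of terms of equal value ([pair_up],
    [merge_pairs]): this leaves q elements of C and k terms of distinct values,
    with 2 q + k = 2 n + 3, so that k is odd and at most 15. A block is a set of
    these k terms whose values have sum zero; disjoint blocks can be replaced by
    their sums, which are in C. For k at most 5 this already produces n elements
    of C. For larger k, unless this happens again, one finds disjoint blocks that
    bring the number of elements of C to n - 1, so that all of them have the same
    sum g, a generator of C ([full_packing]). Different choices of such blocks
    cover the same terms in different ways, and comparing them gives m g = 0 for
    some m strictly between 0 and n, a contradiction. For k = 7 and k = 9 the
    values contain a basis of V, apart from an easy case ([seven_low_rank]), which
    leaves finitely many sets to consider, and a computation reduces them to one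
    shape each, an affine hyperplane without a point and an affine hyperplane with
    a direction ([seven_distinct], [nine_distinct]); for k = 7 one of the merged
    pairs has to be separated again. For k = 11, 13 and 15 the few values that are
    missing are in one of three positions, or else twelve values lie off a plane
    and are partitioned into lines in several ways ([eleven_distinct],
    [thirteen_distinct], [fifteen_distinct]). Hence zero-sum free sequences have at
    most 2 n + 2 terms ([zero_sum_free_bound]).

    Lower bounds. With e_1, e_2, e_3 of order 2 and e of order 2 n as a basis,
    e_1 e_2 e_3 e^(2 n - 1) is zero-sum free, whence d(G) = 2 n + 2. A zero-sum free
    sequence of this length has every nonzero element among its sums, since it
    cannot be extended; hence nu_2(G) is at most 2 n + 2, and nu(G) is at most
    nu_2(G) because subgroups of index 2 are proper. Conversely, for c = (n + 1) / 2
    the sequence of e_1 + c e, e_2 + c e, e_3 + c e, e_1 + e_2 + e_3 + c e and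
    2 n - 3 copies of e is zero-sum free of length 2 n + 1, and the elements that it
    misses are not contained in any coset a + H with a outside H ([nu_ge]). The
    invariant factors 2, 2, 2, 2 n give d*(G) = 2 n + 2 as well. *)

(** * Binary words and two finite verifications *)

(** Words over F_2 serve two purposes: a word of length 4 is the coordinate
    vector (label) of an element of order at most 2, and a word as long as a
    sequence selects some of its terms. *)
Definition addw (u w : bitseq) : bitseq := [seq x.1 (+) x.2 | x <- zip u w].
Definition disjw (u w : bitseq) : bool := ~~ has (fun x => x.1 && x.2) (zip u w).

Definition zerol : bitseq := nseq 4 false.
Definition label_sum (ls : seq bitseq) (B : seq nat) : bitseq :=
  foldr addw zerol [seq nth zerol ls i | i <- B].

(** Only labels occur here, so that packings of explicit labels are recognized
    by computation. *)
Definition packing (ls : seq bitseq) (P : seq (seq nat)) : bool :=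
  uniq (flatten P) &&
  all (fun B => [&& B != [::], all (fun i => i < size ls)%N B
                  & label_sum ls B == zerol]) P.

Lemma size_addw u w : size u = size w -> size (addw u w) = size u.
Proof. by move=> E; rewrite size_map size_zip E minnn. Qed.

(** [has] by conditionals, which stop at the first witness under any evaluation
    strategy; the other tests below are written in the same way. *)
Fixpoint some (T : Type) (f : T -> bool) (s : seq T) : bool :=
  if s is x :: s' then if f x then true else some f s' else false.

Lemma someE (T : Type) (f : T -> bool) s : some f s = has f s.
Proof. by elim: s => //= x s ->; case: (f x). Qed.

Fixpoint words k : seq bitseq :=
  if k is k'.+1 then map (cons false) (words k') ++ map (cons true) (words k')
  else [:: [::]].

Definition unitl : seq bitseq :=
  [:: [:: true; false; false; false]; [:: false; true; false; false];
      [:: false; false; true; false]; [:: false; false; false; true]].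

Definition nonunitl : seq bitseq :=
  Eval compute in [seq l <- words 4 | l \notin unitl].

(** The labels [ls] are followed by the four unit labels: each choice among the
    former extends in one way, by the coordinates of what is left of [t]. *)
Fixpoint code (ls : seq bitseq) (t : bitseq) : seq bitseq :=
  if ls is l :: ls' then
    map (cons false) (code ls' t) ++ map (cons true) (code ls' (addw l t))
  else [:: t].

Definition relations ls : seq bitseq := [seq w <- code ls zerol | has id w].

Fixpoint meetsw (u w : bitseq) : bool :=
  if u is x :: u' then if w is y :: w' then
    if (if x then y else false) then true else meetsw u' w' else false else false.

Fixpoint meetsw3 (u w z : bitseq) : bool :=
  if u is x1 :: u' then if w is x2 :: w' then if z is x3 :: z' then
    if (if x1 then if x2 then x3 else false else false) then true
    else meetsw3 u' w' z' else false else false else false.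

Definition orw (u w : bitseq) : bitseq := [seq x.1 || x.2 | x <- zip u w].

Fixpoint subw (u w : bitseq) : bool :=
  if u is x :: u' then if w is y :: w' then
    if (if x then y else true) then subw u' w' else false else false else true.

Fixpoint eqw (u w : bitseq) : bool :=
  match u, w with
  | x :: u', y :: w' => if (if x then y else ~~ y) then eqw u' w' else false
  | [::], [::] => true
  | _, _ => false
  end.

Definition memw (C : seq bitseq) w : bool := some (eqw w) C.

(** Blocks c inside the union of the disjoint blocks h and d have the same sum
    as h, see [linked_eq]. *)
Definition linked (C : seq bitseq) h : seq bitseq :=
  let U := [seq orw h d | d <- C & ~~ meetsw h d] in
  [seq c <- C | some (fun u => if subw c u then ~~ eqw c u else false) U].

(** A contradictory set of blocks of equal sum, see [dependent_triple_eq0]. *)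
Definition dependent_triple (C : seq bitseq) : bool :=
  some (fun c1 => some (fun c2 => if memw C (addw c1 c2) then some (fun c3 =>
    if meetsw3 c1 c2 c3 then false else if memw C (addw c1 c3) then
    if memw C (addw c2 c3) then memw C (addw c1 (addw c2 c3)) else false
    else false) C else false) C) C.

Definition three_disjoint (C : seq bitseq) : bool :=
  some (fun c1 => some (fun c2 => if meetsw c1 c2 then false else
    some (fun c3 => if meetsw c1 c3 then false else ~~ meetsw c2 c3) C) C) C.

(** The affine space through [o] with the given directions; its head is [o]. *)
Definition cube (o h1 h2 h3 : bitseq) : seq bitseq :=
  [seq foldr addw o (mask m [:: h1; h2; h3]) | m <- words 3].

Definition cube_and_direction (ls : seq bitseq) : bool :=
  some (fun w => some (fun o => some (fun o2 => some (fun o3 =>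
    if all (mem ls) (w :: cube o w (addw o o2) (addw o o3))
    then uniq (w :: cube o w (addw o o2) (addw o o3)) else false) ls) ls) ls) ls.

Definition check9 (rest : seq bitseq) : bool :=
  let C := relations rest in
  if three_disjoint C then true else
  if some (fun h => dependent_triple (linked C h)) C then true else
  cube_and_direction (rest ++ unitl).

(** Four of nine distinct values can be made the unit labels as soon as they form
    a basis, and a mask then selects the labels of the other five. *)
Lemma check9P : all (fun m => if count id m == 5 then check9 (mask m nonunitl) else true) (words 12).
Proof. by vm_compute. Qed.

(** * Zero-sum free sequences *)

Import GRing.Theory.
Local Open Scope ring_scope.

Section ZeroSumFreeTheory.
Variable G : finZmodType.
Implicit Types (S T R B p a : seq G) (x y g : G).

Lemma SigmaP S x :
  reflect (exists T, [/\ subseq T S, T != [::] & \sum_(y <- T) y = x]) (x \in Sigma S).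
Proof.
have sum_mask m : size m = size S ->
    \sum_(x <- mask m S) x = \sum_(i < size S | nth false m i) S`_i.
  by move=> sz_m; rewrite big_mask; apply: eq_big => i; rewrite ?andbT ?(tnth_nth 0).
apply: (iffP imsetP) => [[I I0 ->{x}] | [T [/subseqP[m sz_m ->{T}] T0 <-{x}]]]; last first.
  exists [set i : 'I_(size S) | nth false m i].
    rewrite inE; apply: contra T0 => /eqP/setP E.
    suff -> : m = nseq (size S) false by rewrite mask_false.
    apply: (@eq_from_nth _ false); rewrite ?size_nseq // => i.
    rewrite sz_m => lt_i; rewrite nth_nseq lt_i.
    by have := E (Ordinal lt_i); rewrite !inE.
  by rewrite [LHS]sum_mask //; apply: eq_bigl => i; rewrite inE.
pose m := [seq i \in I | i : 'I_(size S)].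
have sz_m : size m = size S by rewrite size_map size_enum_ord.
have nth_m (i : 'I_(size S)) : nth false m i = (i \in I).
  rewrite (nth_map i) ?size_enum_ord //; congr (_ \in I).
  by apply: val_inj; rewrite /= nth_enum_ord.
exists (mask m S); split; first exact: mask_subseq.
  rewrite -size_eq0 size_mask // -lt0n -has_count; apply/hasP.
  rewrite inE in I0; have /set0Pn[i iI] := I0.
  by exists true => //; rewrite -iI -nth_m mem_nth // sz_m.
by rewrite sum_mask //; apply: eq_bigl => i; rewrite nth_m.
Qed.

Lemma zero_sum_freeP S :
  reflect (forall T, subseq T S -> T != [::] -> \sum_(x <- T) x != 0)
          (zero_sum_free S).
Proof.
apply: (iffP idP) => [zfS T sT T0 | H].
  by apply: contra zfS => /eqP sum0; apply/SigmaP; exists T.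
by apply/SigmaP => -[T [sT T0 /eqP]]; apply/negP/H.
Qed.

Lemma zero_sum_free_sum_neq0 S T R :
  zero_sum_free S -> perm_eq S (T ++ R) -> T != [::] -> \sum_(x <- T) x != 0.
Proof.
move=> /zero_sum_freeP zfS pS T0.
have [|T' subT' pT'] := (count_subseqP T S).1.
  by move=> x; rewrite (seq.permP pS) count_cat leq_addr.
rewrite (perm_big _ pT') /=; apply: zfS => //.
by apply: contra T0; rewrite -!size_eq0 (perm_size pT').
Qed.

Lemma zero_sum_freeI S :
  (forall T R, perm_eq S (T ++ R) -> T != [::] -> \sum_(x <- T) x != 0) ->
  zero_sum_free S.
Proof.
move=> H; apply/zero_sum_freeP => T /perm_to_subseq[R pS] T0.
exact: H pS T0.
Qed.

Lemma perm_zero_sum_free S S' :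
  perm_eq S S' -> zero_sum_free S -> zero_sum_free S'.
Proof.
move=> pSS' zfS; apply: zero_sum_freeI => T R pS'.
by apply: (zero_sum_free_sum_neq0 zfS (perm_trans pSS' pS')).
Qed.

Lemma zero_sum_free_catl S R : zero_sum_free (S ++ R) -> zero_sum_free S.
Proof.
move=> zf; apply: zero_sum_freeI => T R' pS T0.
apply: (zero_sum_free_sum_neq0 (R := R' ++ R) zf) => //.
by rewrite catA perm_cat2r.
Qed.

Lemma zero_sum_free_merge B R :
  B != [::] -> zero_sum_free (B ++ R) -> zero_sum_free (\sum_(x <- B) x :: R).
Proof.
move=> B0 zf; set b := \sum_(x <- B) x.
apply: zero_sum_freeI => T R' pT T0.
have : b \in T ++ R' by rewrite -(perm_mem pT) mem_head.
rewrite mem_cat => /orP[bT | bR].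
  have [T' pT'] : {T' | perm_eq T (b :: T')}.
    by exists (rem b T); apply: perm_to_rem.
  rewrite (perm_big _ pT') big_cons /= -big_cat.
  apply: (zero_sum_free_sum_neq0 (R := R') zf); last first.
    by apply: contra B0; rewrite -!size_eq0 size_cat addn_eq0 => /andP[].
  rewrite -catA perm_cat2l -(perm_cons b) (perm_trans pT) //.
  by rewrite -cat_cons perm_cat2r.
have pR' := perm_to_rem bR.
apply: (zero_sum_free_sum_neq0 (R := B ++ rem b R') zf) => //.
rewrite perm_sym perm_catCA perm_cat2l perm_sym -(perm_cons b) (perm_trans pT) //.
by rewrite -[b :: T ++ _]cat1s perm_sym perm_catCA perm_cat2l perm_sym.
Qed.

(** Any family of disjoint nonempty subsequences of a zero-sum free sequence
    may be replaced by the family of their sums, merging one after the other. *)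
Lemma zero_sum_free_blocks (J : eqType) (h : J -> G) (A : seq J) (P : seq (seq J)) p :
    zero_sum_free (p ++ map h A) -> uniq (flatten P) ->
    {subset flatten P <= A} -> [::] \notin P ->
  zero_sum_free (p ++ [seq \sum_(i <- K) h i | K <- P]).
Proof.
move=> zf uP sPA nP.
have [R pA] : exists R : seq J, perm_eq A (flatten P ++ R).
  have [|A' /perm_to_subseq[R pA] pA'] := (count_subseqP (flatten P) A).1.
    move=> x; rewrite (count_uniq_mem _ uP).
    case: (boolP (x \in flatten P)) => //= /sPA xA.
    by rewrite -has_count has_pred1.
  by exists R; apply: perm_trans pA _; rewrite perm_cat2r perm_sym.
have {}zf : zero_sum_free ((p ++ map h R) ++ map h (flatten P)).
  apply: perm_zero_sum_free zf; rewrite -catA perm_cat2l -map_cat.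
  by apply: perm_map; rewrite perm_sym perm_catC perm_sym.
apply: (@zero_sum_free_catl _ (map h R)).
have {zf} : zero_sum_free
    ((p ++ map h R) ++ [seq \sum_(i <- K) h i | K <- P]).
  elim: P (p ++ map h R) zf nP {uP sPA pA} => //= K P IH q.
  rewrite inE negb_or => zf /andP[K0 nP].
  have {}zf : zero_sum_free (rcons q (\sum_(i <- K) h i) ++ map h (flatten P)).
    rewrite -(big_map h xpredT id).
    apply: perm_zero_sum_free (zero_sum_free_merge (B := map h K)
        (R := q ++ map h (flatten P)) _ _); last first.
    - by apply: perm_zero_sum_free zf; rewrite /= map_cat perm_catCA.
    - by apply: contra K0; case: (K).
    - by rewrite cat_rcons -[_ :: q ++ _]cat1s perm_catCA.
  by have := IH _ zf nP; rewrite cat_rcons.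
apply: perm_zero_sum_free; rewrite -!catA perm_cat2l.
by rewrite perm_sym perm_catC perm_sym.
Qed.

Lemma mem_scanl x S y :
  y \in scanl +%R x S ->
  exists T R, [/\ S = T ++ R, T != [::] & y = x + \sum_(z <- T) z].
Proof.
elim: S x => //= z S IH x; rewrite inE => /orP[/eqP-> | /IH[T [R [-> T0 ->]]]].
  by exists [:: z], S; rewrite big_seq1.
by exists (z :: T), R; rewrite big_cons addrA.
Qed.

(** The difference of two initial sums is the sum of a nonempty segment. *)
Lemma uniq_scanl x S : zero_sum_free S -> uniq (x :: scanl +%R x S).
Proof.
elim: S x => //= z S IH x zf.
have zfS : zero_sum_free S.
  by apply: (@zero_sum_free_catl _ [:: z]); apply: perm_zero_sum_free zf;
     rewrite -cat1s perm_catC.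
have := IH (x + z) zfS; rewrite /= => ->; rewrite andbT.
apply/negP => xS; have /mem_scanl[T [R [ST T0 xT]]] :
  x \in scanl +%R x (z :: S) by [].
have := zero_sum_free_sum_neq0 zf (R := R) (T := T) _ T0.
rewrite ST perm_refl => /(_ isT); rewrite -(inj_eq (addrI x)) addr0 -xT eqxx.
by [].
Qed.

End ZeroSumFreeTheory.

(** * Zero-sum free sequences over the elements of order dividing n *)

Section Torsion.
Variables (n : nat) (G : finZmodType).
Hypothesis odd_n : odd n.
Hypothesis cardC : #|[set x : G | x *+ n == 0]| = n.
Implicit Types (S T R p a : seq G) (x y g : G).

Definition odd_torsion : pred G := fun x => x *+ n == 0.
Local Notation inC := odd_torsion.

Lemma odd_torsionD x y : inC x -> inC y -> inC (x + y).
Proof. by rewrite /inC mulrnDl => /eqP-> /eqP->; rewrite addr0. Qed.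

Lemma odd_torsionMn x k : inC x -> inC (x *+ k).
Proof. by rewrite /inC mulrnAC => /eqP->; rewrite mul0rn. Qed.

Lemma odd_torsion_double_eq0 x : inC x -> x *+ 2 = 0 -> x = 0.
Proof.
move=> /eqP xn x2; rewrite -xn -[n in RHS]odd_double_half odd_n mulrnDr.
by rewrite -muln2 mulnC mulrnA x2 mul0rn addr0.
Qed.

Lemma odd_torsion_double_inj x y : inC x -> inC y -> x *+ 2 = y *+ 2 -> x = y.
Proof.
move=> xC yC E; apply/eqP; rewrite -subr_eq0; apply/eqP/odd_torsion_double_eq0.
  by rewrite /inC mulrnBl (eqP xC) (eqP yC) subr0.
by rewrite mulrnBl E subrr.
Qed.

Lemma scanl_odd_torsion x S : inC x -> all inC S -> all inC (x :: scanl +%R x S).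
Proof.
elim: S x => [|y S IH] x xC /=; first by rewrite xC.
case/andP=> yC /IH h; rewrite xC /=.
by have /= := h _ (odd_torsionD xC yC).
Qed.

Lemma scanl_sub S :
  all inC S -> {subset 0 :: scanl +%R 0 S <= enum [set x | inC x]}.
Proof.
move=> SC x xS; rewrite mem_enum inE.
by apply: (allP (scanl_odd_torsion _ SC)) xS; rewrite /inC mul0rn.
Qed.

Lemma zero_sum_free_torsion_size S :
  all inC S -> zero_sum_free S -> (size S < n)%N.
Proof.
move=> SC zf; have := uniq_leq_size (uniq_scanl 0 zf) (scanl_sub SC).
by rewrite /= size_scanl -cardE cardC.
Qed.

(** A zero-sum free sequence of the maximal possible length n - 1 in a group of
    order n has n distinct initial sums, hence reaches every element; moving two
    different terms x, y to the front would make y equal to 0, to x or to a sum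
    starting with x + y, and the last leaves a zero sum. *)
Lemma zero_sum_free_torsion_const S :
  all inC S -> zero_sum_free S -> (size S).+1 = n -> {in S &, forall x y, x = y}.
Proof.
move=> SC zf sz x y xS yS; apply: contraTeq isT => neq_xy.
have pS := perm_to_rem xS; set R := rem x S in pS.
have yR : y \in R.
  by move: yS; rewrite (perm_mem pS) inE eq_sym (negPf neq_xy).
have {}pS : perm_eq S (x :: y :: rem y R).
  by apply: perm_trans pS _; rewrite perm_cons perm_to_rem.
set R' := rem y R in pS; set S' := x :: y :: R' in pS.
have zf' := perm_zero_sum_free pS zf.
have SC' : all inC S' by rewrite -(perm_all _ pS).
have [|_ mem_all] := uniq_min_size (uniq_scanl 0 zf') (scanl_sub SC').
  by rewrite -cardE cardC /= size_scanl -sz (perm_size pS).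
have : y \in 0 :: scanl +%R 0 S' by rewrite mem_all mem_enum inE (allP SC).
have y0 : y != 0.
  by rewrite -[y](big_seq1 (@GRing.add _) y id);
     apply: (zero_sum_free_sum_neq0 zf (R := rem y S)) => //; rewrite perm_to_rem.
rewrite inE (negPf y0) => /mem_scanl[T [R'' [ST T0]]]; rewrite add0r.
case: T ST T0 => [//|z [|z' T]]; first by
  case=> <- _ _; rewrite big_seq1 => yx; rewrite yx eqxx in neq_xy.
case=> <- <- E _; rewrite !big_cons addrCA -[X in X = _]addr0 => /addrI sum0.
have := zero_sum_free_sum_neq0 zf' (T := x :: T) (R := y :: R'').
rewrite big_cons -sum0 eqxx => h; apply: h => //.
rewrite /S' E /= perm_cons.
by rewrite -[y :: T ++ _]cat1s -[y :: R'']cat1s perm_catCA.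
Qed.

(** As the elements of [odd_torsion] are n in number, g generates them. *)
Definition saturating g := inC g && zero_sum_free (nseq n.-1 g).

Lemma saturating_neq0 g k : saturating g -> (0 < k < n)%N -> g *+ k != 0.
Proof.
case/andP=> _ zf k_n.
rewrite -[_ *+ _](_ : \sum_(x <- nseq k g) x = _); last first.
  by rewrite big_nseq iter_addr_0.
apply: (zero_sum_free_sum_neq0 (R := nseq (n.-1 - k) g) zf).
  by rewrite cat_nseq /ncons -iterD -/(ncons _ _ _) subnKC //; lia.
by case: k k_n.
Qed.

Lemma saturating_torsion g : saturating g -> inC g.
Proof. by case/andP. Qed.

Lemma saturating_mul_inj g i j : saturating g -> (i < n)%N -> (j < n)%N ->
  g *+ i = g *+ j -> i = j.
Proof.
move=> sat; wlog le_ij : i j / (i <= j)%N.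
  by move=> W; case/orP: (leq_total i j) => le_ij ? ? E; [|symmetry]; apply: W.
move=> lt_i lt_j E; apply/eqP; rewrite eqn_leq le_ij /= leqNgt.
apply/negP => lt_ij.
have /eqP[] : g *+ (j - i) != 0 by apply: saturating_neq0 => //; lia.
by rewrite mulrnBr // E subrr.
Qed.

Lemma saturating_gen g x : saturating g -> inC x -> exists2 t, (t < n)%N & x = g *+ t.
Proof.
move=> sat xC.
have [n0|n_gt0] := posnP n; first by move: odd_n; rewrite n0.
have uM : uniq [seq g *+ t | t <- iota 0 n].
  rewrite map_inj_in_uniq ?iota_uniq // => i j; rewrite !mem_iota /= => ? ?.
  by apply: saturating_mul_inj.
have sM : {subset [seq g *+ t | t <- iota 0 n] <= enum [set x | inC x]}.
  move=> y /mapP[t _ ->]; rewrite mem_enum inE.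
  exact/odd_torsionMn/saturating_torsion.
have [|_ mem_all] := uniq_min_size uM sM.
  by rewrite -cardE cardC size_map size_iota.
have : x \in [seq g *+ t | t <- iota 0 n] by rewrite mem_all mem_enum inE.
by case/mapP=> t; rewrite mem_iota => ? ->; exists t.
Qed.

(** If b can be added to all but d of the n - 1 copies of g, then b avoids the
    negatives of the first multiples of g. *)
Lemma saturating_range g b d : saturating g -> inC b -> (d < n)%N ->
    zero_sum_free (nseq (n.-1 - d) g ++ [:: b]) ->
  exists2 t, (0 < t <= d)%N & b = g *+ t.
Proof.
move=> sat bC lt_d zf; have [t lt_t bt] := saturating_gen sat bC.
exists t => //; rewrite lt0n; apply/andP; split.
  apply/eqP => t0; have := zero_sum_free_sum_neq0 zf (T := [:: b])
    (R := nseq (n.-1 - d) g).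
  by rewrite perm_catC perm_refl big_seq1 bt t0 mulr0n eqxx => /(_ isT isT).
rewrite leqNgt; apply/negP => lt_dt.
have /eqP[] : \sum_(x <- nseq (n - t) g ++ [:: b]) x != 0.
  apply: (zero_sum_free_sum_neq0 (R := nseq (t - d.+1) g) zf); last first.
    by rewrite cats1 -size_eq0 size_rcons.
  rewrite perm_sym perm_catAC perm_cat2r cat_nseq /ncons -iterD -/(ncons _ _ _).
  by rewrite (_ : n - t + _ = n.-1 - d)%N //; lia.
rewrite big_cat big_seq1 big_nseq iter_addr_0 /= bt -mulrnDr subnK 1?ltnW //.
exact/eqP/saturating_torsion.
Qed.

End Torsion.

(** * Labels and blocks *)

Section Combinations.
Variable G : finZmodType.
Implicit Types (a b p : seq G) (u w l t : bitseq).

Definition comb b w : G := \sum_(x <- mask w b) x.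

Lemma comb0 b k : comb b (nseq k false) = 0.
Proof. by rewrite /comb mask_false big_nil. Qed.

Lemma comb_cons x b c w : comb (x :: b) (c :: w) = x *+ c + comb b w.
Proof. by rewrite /comb; case: c => /=; rewrite ?big_cons ?add0r ?mulr1n. Qed.

Definition elems w : seq nat := mask w (iota 0 (size w)).

Lemma comb_elems a w : size w = size a -> comb a w = \sum_(i <- elems w) a`_i.
Proof.
move=> sz; rewrite /elems sz -(big_map (nth 0 a) xpredT id) map_mask.
by rewrite map_nth_iota0 // take_size.
Qed.

Lemma mem_elems w i : (i \in elems w) = nth false w i.
Proof.
rewrite in_mask ?iota_uniq // mem_iota /= add0n.
have [lt_i|le_i] := ltnP i (size w); last by rewrite [RHS]nth_default.
have := @index_uniq _ 0%N i (iota 0 (size w)).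
by rewrite size_iota nth_iota // => ->; rewrite ?iota_uniq.
Qed.

Lemma uniq_elems w : uniq (elems w).
Proof. by rewrite mask_uniq ?iota_uniq. Qed.

Lemma elems_eq0 w : (elems w == [::]) = ~~ has id w.
Proof.
by rewrite -size_eq0 size_mask ?size_iota // has_count lt0n negbK.
Qed.

Lemma disjw_elems u w : size u = size w -> disjw u w -> ~~ has (mem (elems u)) (elems w).
Proof.
move=> sz /hasPn dis; apply/hasPn => i; rewrite mem_elems => wi; apply/negP => /=.
rewrite mem_elems => ui; have lt_i : (i < size w)%N.
  by rewrite ltnNge; apply/negP => le_i; rewrite nth_default in wi.
have : nth (false, false) (zip u w) i \in zip u w.
  by rewrite mem_nth // size_zip sz minnn.
by move/dis; rewrite nth_zip //= ui wi.
Qed.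

Lemma uniq_flatten_elems k ws : all (fun w => size w == k) ws ->
  pairwise disjw ws -> uniq (flatten (map elems ws)).
Proof.
elim: ws => //= w ws IH /andP[/eqP szw szs] /andP[dis pw].
rewrite cat_uniq uniq_elems IH // andbT /=.
apply/hasPn => i /flatten_mapP[u u_ws iu]; apply/negP => iw.
have szu : size w = size u by rewrite szw (eqP (allP szs u u_ws)).
by move/hasPn: (disjw_elems szu (allP dis u u_ws)) => /(_ i iu)/negP; apply.
Qed.

Lemma comb_addw b u w : all (fun x => x *+ 2 == 0) b ->
  size u = size b -> size w = size b -> comb b (addw u w) = comb b u + comb b w.
Proof.
elim: b u w => [|x b IH] [|c u] [|d w] //= h; rewrite ?/comb ?big_nil ?addr0 //.
case/andP: h => /eqP x2 h [szu] [szw]; rewrite -!/(comb _ _).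
rewrite [addw _ _]/= !comb_cons IH // addrACA; congr (_ + _).
by case: c d => -[]; rewrite /= ?addr0 ?add0r -?mulr2n.
Qed.

End Combinations.

Section Blocks.
Variables (n : nat) (G : finZmodType).
Hypothesis cardC : #|[set x : G | x *+ n == 0]| = n.
Implicit Types (a b p : seq G).
Local Notation inC := (@odd_torsion n G).

(** Coordinates of the values of [a] with respect to [b]: by [packing_blocks],
    whether some terms have their sum in [odd_torsion] becomes a computation
    with words. *)
Definition labelled b (ls : seq bitseq) a : Prop :=
  [/\ size b = 4, all (fun x => x *+ 2 == 0) b, all (fun l => size l == 4) ls
    & [seq x *+ n | x <- a] = map (comb b) ls].

Definition block_sum a (B : seq nat) : G := \sum_(i <- B) a`_i.

Lemma size_label_sum ls B : all (fun l => size l == 4) ls -> size (label_sum ls B) = 4.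
Proof.
move=> sz4; rewrite /label_sum; elim: B => //= i B IH.
have sz_i : size (nth zerol ls i) = 4.
  have [lt_i|le_i] := ltnP i (size ls); last by rewrite nth_default.
  exact/eqP/(allP sz4)/mem_nth.
by rewrite size_addw sz_i ?IH.
Qed.

Lemma block_sumMn b ls a B : labelled b ls a -> all (fun i => i < size ls)%N B ->
  block_sum a B *+ n = comb b (label_sum ls B).
Proof.
case=> sz_b b2 sz4 E; have sz_a : size a = size ls.
  by rewrite -(size_map (comb b)) -E size_map.
rewrite /block_sum -sumrMnl; elim: B => [|i B IH].
  by rewrite big_nil /label_sum /zerol comb0.
case/andP=> lt_i /IH{}IH; rewrite big_cons IH /= /label_sum /= comb_addw //.
- congr (_ + _).
  by rewrite -(nth_map 0 0 (fun x => x *+ n)) ?sz_a // E (nth_map zerol).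
- by rewrite (eqP (allP sz4 _ (mem_nth _ _))) ?sz_b.
- by rewrite -/(label_sum ls B) size_label_sum ?sz_b.
Qed.

Definition blocks a (P : seq (seq nat)) : bool :=
  uniq (flatten P) &&
  all (fun B => [&& B != [::], all (fun i => i < size a)%N B
                  & inC (block_sum a B)]) P.

Lemma packing_blocks b ls a P : labelled b ls a -> packing ls P -> blocks a P.
Proof.
move=> lab /andP[uP allP']; rewrite /blocks uP /=.
have sz_a : size a = size ls.
  by case: lab => _ _ _ E; rewrite -(size_map (comb b)) -E size_map.
apply: sub_all allP' => B /and3P[-> ltB /eqP sB]; rewrite sz_a ltB /=.
by rewrite /odd_torsion (block_sumMn lab ltB) sB comb0.
Qed.

Lemma blocks_torsion a P : blocks a P -> all inC (map (block_sum a) P).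
Proof. by case/andP=> _ aP; rewrite all_map; apply: sub_all aP => B /and3P[]. Qed.

Lemma blocks_zero_sum_free a p P : blocks a P -> zero_sum_free (p ++ a) ->
  zero_sum_free (p ++ map (block_sum a) P).
Proof.
case/andP=> uP aP zf.
apply: (zero_sum_free_blocks (A := iota 0 (size a)) (h := nth 0 a)) => //.
- by rewrite map_nth_iota0 // take_size.
- move=> i /flattenP[B /(allP aP)/and3P[_ ltB _] iB].
  by rewrite mem_iota (allP ltB).
- by apply/negP => /(allP aP) /=.
Qed.

(** Replacing the blocks by their sums gives a zero-sum free sequence inside
    [odd_torsion], of length at most n - 1; in the case of equality its terms
    coincide, which is the next lemma. *)
Lemma blocks_size a p P :
    zero_sum_free (p ++ a) -> all inC p -> blocks a P ->
  (size p + size P < n)%N.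
Proof.
move=> zf pC PP; rewrite -(size_map (block_sum a)) -size_cat.
apply: (zero_sum_free_torsion_size cardC) (blocks_zero_sum_free PP zf).
by rewrite all_cat pC blocks_torsion.
Qed.

Lemma blocks_const a p P :
    zero_sum_free (p ++ a) -> all inC p -> blocks a P ->
    (size p + size P).+1 = n ->
  {in p ++ map (block_sum a) P &, forall x y, x = y}.
Proof.
move=> zf pC PP sz.
apply: (zero_sum_free_torsion_const cardC) (blocks_zero_sum_free PP zf) _.
  by rewrite all_cat pC blocks_torsion.
by rewrite size_cat size_map.
Qed.

Lemma words_blocks a ws :
    all (fun w => [&& size w == size a, has id w & inC (comb a w)]) ws ->
    pairwise disjw ws ->
  blocks a (map elems ws).
Proof.
move=> aws pw; apply/andP; split.
  apply: (@uniq_flatten_elems (size a)) => //.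
  by apply: sub_all aws => w /and3P[].
rewrite all_map; apply: sub_all aws => w /and3P[/eqP szw w0 cw] /=.
rewrite elems_eq0 w0 /block_sum -comb_elems // cw andbT /=.
by apply/allP => i /mem_mask; rewrite mem_iota szw.
Qed.

End Blocks.

(** * Bases of the elements of order at most two *)

Lemma mem_words k w : (w \in words k) = (size w == k).
Proof.
elim: k w => [|k IH] [|c w] //=.
  by rewrite mem_cat; apply/orP; case=> /mapP[].
rewrite mem_cat eqSS -IH; apply/orP/idP => [[]/mapP[u u_k [_ ->]] // | wk].
by case: c; [right | left]; apply: map_f.
Qed.

Lemma uniq_words k : uniq (words k).
Proof.
elim: k => //= k IH; rewrite cat_uniq !map_inj_uniq ?IH ?andbT //=; try by move=> u w [].
by apply/hasPn => w /mapP[u _ ->]; apply/negP => /mapP[].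
Qed.

Lemma size_words k : size (words k) = (2 ^ k)%N.
Proof. by elim: k => //= k IH; rewrite size_cat !size_map IH addnn -mul2n expnS. Qed.

Lemma perm_words4 : perm_eq (words 4) (nonunitl ++ unitl).
Proof. by []. Qed.

Section Frames.
Variable G : finZmodType.
Hypothesis card2 : #|[set x : G | x *+ 2 == 0]| = 16%N.
Implicit Types (a b p : seq G) (x y : G) (l : bitseq).
Let inV : pred G := fun x => x *+ 2 == 0.

Definition span b : seq G := map (comb b) (words (size b)).
(** Linear independence over F_2, as distinctness of all combinations. *)
Definition independent b := all inV b && uniq (span b).

Lemma spanP b x : reflect (exists2 l, size l = size b & x = comb b l) (x \in span b).
Proof.
apply: (iffP mapP) => [[l] | [l sz ->]].
  by rewrite mem_words => /eqP; exists l.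
by exists l; rewrite // mem_words sz.
Qed.

Lemma span_inV b : all inV b -> all inV (span b).
Proof.
move=> bV; apply/allP => x /spanP[l _ ->]; rewrite /inV /comb -sumrMnl big1_seq //.
by move=> y /andP[_ /mem_mask/(allP bV)/eqP].
Qed.

Lemma independent_cons b x :
  independent b -> inV x -> x \notin span b -> independent (x :: b).
Proof.
case/andP=> bV ub xV xb; rewrite /independent /= xV bV /= /span /= map_cat.
rewrite -!map_comp (eq_map (g := comb b)); last first.
  by move=> l; rewrite /= comb_cons mulr0n add0r.
rewrite [X in _ ++ X](eq_map (g := fun l => x + comb b l)); last first.
  by move=> l; rewrite /= comb_cons mulr1n.
rewrite cat_uniq -/(span b) ub /=; apply/andP; split.
  apply/hasPn => y /mapP[l l_b ->]; apply: contra xb => /spanP[l' sz' E].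
  rewrite mem_words in l_b.
  apply/spanP; exists (addw l' l); first by rewrite size_addw ?sz' ?(eqP l_b).
  rewrite comb_addw ?(eqP l_b) // -E -addrA -mulr2n -[LHS]addr0; congr (_ + _).
  apply/esym/eqP/(allP (span_inV bV))/spanP.
  by exists l; rewrite ?(eqP l_b).
by rewrite (map_comp (+%R x)) map_inj_uniq //; apply: addrI.
Qed.

Lemma independent_full b x : independent b -> size b = 4 -> inV x -> x \in span b.
Proof.
case/andP=> bV ub sz_b xV.
have sub : {subset span b <= enum [set y | inV y]}.
  by move=> y /(allP (span_inV bV)); rewrite mem_enum inE.
have [|_ ->] := uniq_min_size ub sub; last by rewrite mem_enum inE.
by rewrite -cardE card2 size_map size_words sz_b.
Qed.

Lemma independent_extend b : independent b -> (size b < 4)%N ->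
  exists2 x, inV x & x \notin span b.
Proof.
case/andP=> bV ub lt_b.
case: (boolP [exists x, inV x && (x \notin span b)]) => [/existsP[x /andP[]] | ].
  by exists x.
rewrite negb_exists => /forallP all_b.
have: (size (enum [set y | inV y]) <= size (span b))%N.
  apply: uniq_leq_size (enum_uniq _) _ => x; rewrite mem_enum inE => xV.
  by have := all_b x; rewrite xV negbK.
rewrite -cardE card2 size_map size_words leqNgt => /negP[].
have: (2 ^ size b < 2 ^ 4)%N by rewrite ltn_exp2l.
by [].
Qed.

Lemma independent_complete b k : independent b -> (size b + k = 4)%N ->
  exists b', [/\ size b' = k, independent (b' ++ b) & size (b' ++ b) = 4].
Proof.
elim: k b => [|k IH] b ib sz; first by exists [::]; rewrite addn0 in sz.
have [|x xV xb] := independent_extend ib; first by rewrite -sz; lia.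
have [|b' [sz' ib' sz4]] := IH (x :: b) (independent_cons ib xV xb).
  by rewrite /= -sz; lia.
exists (rcons b' x); rewrite cat_rcons; split=> //.
by rewrite size_rcons sz'.
Qed.

(** Greedy choice of a basis inside a large set of vectors. *)
Lemma independent_in A k : all inV A -> uniq A -> (2 ^ k < (size A).*2)%N ->
  exists2 b, size b = k & independent b /\ {subset b <= A}.
Proof.
move=> AV uA; elim: k => [|k IH] ltA.
  by exists [::] => //; split=> //; rewrite /independent.
have [|b sz_b [ib bA]] := IH.
  by apply: leq_ltn_trans ltA; rewrite leq_exp2l.
have [x xA xb] : exists2 x, x \in A & x \notin span b.
  apply/allPn; apply: contraTN ltA => /allP sub; rewrite -leqNgt.
  rewrite expnS mul2n leq_double -sz_b -size_words -(size_map (comb b)).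
  exact: uniq_leq_size.
exists (x :: b); rewrite /= ?sz_b //; split.
  by apply: independent_cons => //; apply: (allP AV).
by move=> y; rewrite inE => /predU1P[-> | /bA].
Qed.

Lemma comb_inj b u w : independent b -> size u = size b -> size w = size b ->
  comb b u = comb b w -> u = w.
Proof.
case/andP=> _ ub su sw E.
have u_b : u \in words (size b) by rewrite mem_words su.
have w_b : w \in words (size b) by rewrite mem_words sw.
have sz (x : bitseq) : x \in words (size b) -> comb b x = nth 0 (span b) (index x (words (size b))).
  by move=> xb; rewrite (nth_map x) ?index_mem // nth_index.
move: E; rewrite !sz // => /eqP; rewrite nth_uniq ?size_map ?index_mem //.
by move=> /eqP E; rewrite -(nth_index u u_b) E nth_index.
Qed.

End Frames.

(** * Full packings *)

(** The group C_2^4 + C_n for odd n, through the orders of its two summands. *)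
Record elementary_by_odd (n : nat) (G : finZmodType) : Prop := ElementaryByOdd {
  ebo_odd : odd n;
  ebo_gt2 : (2 < n)%N;
  ebo_cardC : #|[set x : G | x *+ n == 0]| = n;
  ebo_cardV : #|[set x : G | x *+ 2 == 0]| = 16%N;
  ebo_exp : forall x : G, x *+ n *+ 2 = 0 }.

Section FullPackings.
Variables (n : nat) (G : finZmodType).
Hypothesis ctx : elementary_by_odd n G.
Implicit Types (p a b : seq G) (x y g : G) (B : seq nat) (P Q : seq (seq nat)).
Local Notation inC := (@odd_torsion n G).
Let odd_n := ebo_odd ctx.
Let n_gt2 := ebo_gt2 ctx.
Let cardC := ebo_cardC ctx.

Lemma all_V a : all (fun x => x *+ 2 == 0) [seq x *+ n | x <- a].
Proof. by apply/allP => _ /mapP[x _ ->]; rewrite (ebo_exp ctx). Qed.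

(** Distinct values determine their terms, so that prescribed values can be
    moved to the front in any order. *)
Lemma arrange a (L : seq G) : uniq [seq x *+ n | x <- a] -> uniq L ->
    {subset L <= [seq x *+ n | x <- a]} ->
  exists a' r, perm_eq a (a' ++ r) /\ [seq x *+ n | x <- a'] = L.
Proof.
move=> ua uL sub; pose pt x := nth 0 a (index x [seq x *+ n | x <- a]).
have ptK x : x \in L -> pt x *+ n = x.
  move=> /sub xa; rewrite /pt -(nth_map 0 0 (fun x => x *+ n)) ?nth_index //.
  by rewrite -(size_map (fun x => x *+ n)) index_mem.
have mapL : [seq x *+ n | x <- map pt L] = L.
  by rewrite -map_comp map_id_in.
have uptL : uniq (map pt L) by apply: (@map_uniq _ _ (fun x => x *+ n)); rewrite mapL.
exists (map pt L), [seq x <- a | x \notin map pt L]; split=> //.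
rewrite -(perm_filterC (mem (map pt L)) a) perm_cat2r.
apply: uniq_perm => // [|x]; first exact/filter_uniq/map_uniq/ua.
rewrite mem_filter /=; case: (boolP (x \in map pt L)) => //= /mapP[y /sub ya ->].
by rewrite /pt mem_nth // -(size_map (fun x => x *+ n)) index_mem.
Qed.

Lemma zero_sum_free_perm_catl p a a' r :
  perm_eq a (a' ++ r) -> zero_sum_free (p ++ a) -> zero_sum_free (p ++ a').
Proof.
move=> pa zf; apply: (@zero_sum_free_catl _ _ r).
by apply: perm_zero_sum_free zf; rewrite -catA perm_cat2l.
Qed.

Lemma block_sum_perm a P Q : perm_eq (flatten P) (flatten Q) ->
  \sum_(B <- P) block_sum a B = \sum_(B <- Q) block_sum a B.
Proof.
move=> pPQ; rewrite /block_sum -!(big_flatten _ _ (fun _ => true)) /=.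
exact: perm_big.
Qed.

Lemma const_seq (T : eqType) (s : seq T) (x : T) : {in s, forall y : T, y = x} -> s = nseq (size s) x.
Proof. by move=> h; apply/all_pred1P/allP => y /h->; apply: eqxx. Qed.

(** Together with [p] the blocks number n - 1, the largest possible number, so
    that all of them have the same sum. *)
Lemma full_packing b ls a p P B :
    labelled n b ls a -> zero_sum_free (p ++ a) -> all inC p ->
    packing ls P -> (size p + size P).+1 = n -> B \in P ->
  [/\ saturating n (block_sum a B), p = nseq (size p) (block_sum a B)
    & {in P, forall B', block_sum a B' = block_sum a B}].
Proof.
move=> lab zf pC PP sz BP; have bl := packing_blocks lab PP.
have E := blocks_const cardC zf pC bl sz.
have inPB B' : B' \in P -> block_sum a B' \in p ++ map (block_sum a) P.
  by move=> BP'; rewrite mem_cat map_f ?orbT.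
have EB' B' : B' \in P -> block_sum a B' = block_sum a B.
  by move=> BP'; apply: E; apply: inPB.
split=> //; last first.
  by apply: const_seq => y yp; apply: E; rewrite ?inPB // mem_cat yp.
have CB : inC (block_sum a B).
  by apply: (allP (blocks_torsion bl)); apply: map_f.
rewrite /saturating CB /=.
suff -> : nseq n.-1 (block_sum a B) = p ++ map (block_sum a) P.
  exact: blocks_zero_sum_free bl zf.
rewrite -sz /= -(size_map (block_sum a) P) -size_cat; apply/esym/const_seq => y.
by move=> /E; apply; apply: inPB.
Qed.

Lemma packing_torsion b ls a B : labelled n b ls a -> packing ls [:: B] ->
  inC (block_sum a B).
Proof. by move=> lab /(packing_blocks lab)/blocks_torsion; rewrite /= andbT. Qed.

(** With d of the n - 1 copies of g missing, one more block has at most d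
    possible sums. *)
Lemma packing_range b ls a B g d :
    labelled n b ls a -> packing ls [:: B] -> saturating n g -> (d < n)%N ->
    zero_sum_free (nseq (n.-1 - d) g ++ a) ->
  exists2 t, (0 < t <= d)%N & block_sum a B = g *+ t.
Proof.
move=> lab PB sat lt_d zf; apply: (saturating_range odd_n cardC sat _ lt_d).
  exact: packing_torsion lab PB.
exact: (blocks_zero_sum_free (packing_blocks lab PB) zf).
Qed.

(** The direction 0100 and the eight points of first coordinate 1. *)
Definition cube_labels : seq bitseq :=
  [:: false; true; false; false] :: [seq true :: m | m <- words 3].

(** The eight points of an affine hyperplane together with one direction: each
    plane of the hyperplane splits it into two blocks, whence a common sum g for
    the planes and for the lines through the direction w. Doubling twice, the
    block made of w and of four points with sum w has 4 F = 6 g, although it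
    must have sum g or 2 g. *)
Lemma no_cube b a p :
    labelled n b cube_labels a -> all inC p -> (size p).+3 = n ->
  ~ zero_sum_free (p ++ a).
Proof.
move=> lab pC sz_p zf.
have full P B : packing cube_labels P -> size P = 2 -> B \in P ->
    [/\ saturating n (block_sum a B), p = nseq (size p) (block_sum a B)
      & {in P, forall B', block_sum a B' = block_sum a B}].
  by move=> PP szP; apply: full_packing lab zf pC PP _; rewrite szP addn2.
pose O := block_sum a [:: 1; 2; 3; 4; 5; 6; 7; 8]%N.
pose K := [:: 2; 6; 3; 7]%N; pose g := block_sum a K.
have [sat pg _] : [/\ saturating n g, p = nseq (size p) g & _] :=
  full [:: K; [:: 1; 5; 4; 8]%N] K isT erefl isT.
have plane B B' : packing cube_labels [:: B; B'] ->
    perm_eq (B ++ B') [:: 1; 2; 3; 4; 5; 6; 7; 8]%N -> O = block_sum a B *+ 2.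
  move=> PB pB; have [_ _ E] := full _ B PB erefl (mem_head _ _).
  rewrite mulr2n -{2}(E B') ?inE ?eqxx ?orbT //.
  rewrite /O /block_sum -(perm_big _ pB) big_cat //.
have Og : O = g *+ 2 by apply: (plane _ [:: 1; 5; 4; 8]%N).
have planeg B B' : packing cube_labels [:: B; B'] ->
    perm_eq (B ++ B') [:: 1; 2; 3; 4; 5; 6; 7; 8]%N -> block_sum a B = g.
  move=> PB pB; apply: (odd_torsion_double_inj odd_n); last by rewrite -(plane B B') // Og.
    have [sB _ _] := full _ B PB erefl (mem_head _ _).
    exact: saturating_torsion sB.
  exact: saturating_torsion sat.
have lineg B B' B'' : packing cube_labels [:: B; B'] ->
    packing cube_labels [:: B'; B''] -> perm_eq (B' ++ B'') [:: 1; 2; 3; 4; 5; 6; 7; 8]%N ->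
    block_sum a B = g.
  move=> PB PB' pB; rewrite -(planeg B' B'') //.
  by have [_ _ ->] := full _ B' PB erefl (mem_last _ [:: B']); rewrite ?inE ?eqxx.
pose w := block_sum a [:: 0]%N; pose s := block_sum a [:: 1; 3; 2; 8]%N.
have w4 : w *+ 4 + O = g *+ 4.
  have := @block_sum_perm a [:: [:: 0; 1; 5]; [:: 0; 2; 6]; [:: 0; 3; 7]; [:: 0; 4; 8]]%N
    [:: [:: 0]; [:: 0]; [:: 0]; [:: 0]; [:: 1; 2; 3; 4; 5; 6; 7; 8]]%N isT.
  rewrite !big_cons !big_nil.
  rewrite (lineg _ [:: 2; 6; 3; 7] [:: 1; 5; 4; 8])%N //.
  rewrite (lineg _ [:: 1; 5; 3; 7] [:: 2; 6; 4; 8])%N //.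
  rewrite (lineg _ [:: 1; 5; 2; 6] [:: 3; 7; 4; 8])%N //.
  rewrite (lineg _ [:: 1; 5; 2; 6] [:: 3; 7; 4; 8])%N //.
  by rewrite !addr0 -/w -/O !addrA -!mulr2n -!mulrSr => <-.
have s2 : O + s *+ 2 = g *+ 4.
  have := @block_sum_perm a [:: [:: 3; 2; 8; 5]; [:: 1; 2; 8; 7]; [:: 1; 3; 8; 6];
      [:: 1; 3; 2; 4]]%N
    [:: [:: 1; 2; 3; 4; 5; 6; 7; 8]; [:: 1; 3; 2; 8]; [:: 1; 3; 2; 8]]%N isT.
  rewrite !big_cons !big_nil.
  rewrite (planeg _ [:: 1; 4; 6; 7])%N // (planeg _ [:: 3; 4; 5; 6])%N //.
  rewrite (planeg _ [:: 2; 4; 5; 7])%N // (planeg _ [:: 5; 6; 7; 8])%N //.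
  by rewrite !addr0 -/s -/O !addrA -!mulr2n -!mulrSr => ->; rewrite ?mulr2n ?addrA.
have [t t12 Et] : exists2 t, (0 < t <= 2)%N & block_sum a [:: 0; 1; 3; 2; 8]%N = g *+ t.
  apply: (packing_range lab _ sat n_gt2) => //.
  by rewrite (_ : n.-1 - 2 = size p)%N -?pg //; rewrite -sz_p /= subn2.
have E4 : g *+ (4 * t) = g *+ 6.
  rewrite mulnC mulrnA -Et.
  have -> : block_sum a [:: 0; 1; 3; 2; 8]%N = w + s.
    by rewrite /w /s /block_sum big_cons big_seq1.
  have s2g : s *+ 2 = g *+ 2 by apply: (addrI O); rewrite s2 Og -mulrnDr.
  have s4 : s *+ 4 = g *+ 4 by rewrite [LHS](mulrnA s 2 2) s2g -mulrnA.
  by apply: (addIr O); rewrite mulrnDl addrAC w4 s4 Og -!mulrnDr.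
have g2 : g *+ 2 = 0.
  case: t t12 E4 {Et} => [|[|[|t]]] // _ E.
    by apply: (addrI (g *+ 4)); rewrite -mulrnDr addr0 -[RHS]/(g *+ (4 * 1)) E.
  by apply: (addrI (g *+ 6)); rewrite -mulrnDr addr0 -E.
by have := saturating_neq0 odd_n cardC (k := 2) sat; rewrite g2 eqxx n_gt2 => /(_ isT).
Qed.

End FullPackings.

(** * Sums over words *)

Lemma meetswE u w : meetsw u w = has (fun x => x.1 && x.2) (zip u w).
Proof. by elim: u w => [|x u IH] [|y w] //=; rewrite IH; case: x y => -[]. Qed.

Lemma disjwE u w : disjw u w = ~~ meetsw u w.
Proof. by rewrite meetswE. Qed.

Lemma eqwP u w : reflect (u = w) (eqw u w).
Proof.
elim: u w => [|x u IH] [|y w] /=; try by constructor.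
case: (IH w) => [->|neq]; last by case: x y => -[]; constructor => -[].
by case: x y => -[]; constructor.
Qed.

Lemma memwE C w : memw C w = (w \in C).
Proof.
rewrite /memw someE; apply/hasP/idP => [[u uC /eqwP->] // | wC].
by exists w => //; apply/eqwP.
Qed.

Section WordSums.
Variable G : finZmodType.
Implicit Types (a b : seq G).

Lemma comb_nil w : comb [::] w = 0 :> G.
Proof. by rewrite /comb; case: w => [|c w]; rewrite ?mask0 /= ?big_nil //; case: c; rewrite big_nil. Qed.

Lemma comb_orw a u w : size u = size a -> size w = size a -> ~~ meetsw u w ->
  comb a (orw u w) = comb a u + comb a w.
Proof.
elim: a u w => [|x a IH] [|c u] [|d w] //=; first by rewrite !comb_nil // addr0.
move=> [su] [sw]; rewrite [orw _ _]/= !comb_cons; case: c d => -[] //= dis;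
by rewrite (IH u w) // ?mulr0n ?mulr1n ?add0r // !addrA // (addrC x).
Qed.

Lemma size_orw u w : size u = size w -> size (orw u w) = size u.
Proof. by move=> E; rewrite size_map size_zip E minnn. Qed.

Lemma subw_split a u w : size u = size a -> size w = size a -> subw u w ->
  [/\ ~~ meetsw u (addw u w), comb a w = comb a u + comb a (addw u w)
    & u != w -> has id (addw u w)].
Proof.
elim: a u w => [|x a IH] [|c u] [|d w] //=.
  by split=> //; rewrite !comb_nil ?addr0.
move=> [su] [sw]; rewrite [addw _ _]/= !comb_cons.
case: c d => -[] //= /(IH _ _ su sw)[h1 h2 h3]; split=> //;
  by rewrite ?h2 ?mulr0n ?mulr1n ?add0r // !addrA // (addrC x).
Qed.

(** If no position lies in all three words then the integer identity
    4 xyz = x + y + z - (x + y) - ... + (x + y + z), with sums modulo 2 on the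
    right, has a vanishing left-hand side at each position. *)
Lemma comb_triple a u w z : size u = size a -> size w = size a -> size z = size a ->
    ~~ meetsw3 u w z ->
  comb a u + comb a w + comb a z + comb a (addw u (addw w z)) =
  comb a (addw u w) + comb a (addw u z) + comb a (addw w z).
Proof.
elim: a u w z => [|x a IH] [|c1 u] [|c2 w] [|c3 z] //=.
  by rewrite !comb_nil !addr0.
move=> [su] [sw] [sz]; rewrite ![addw (_ :: _) _]/= !comb_cons.
set A := comb a u; set B := comb a w; set C := comb a z; set D := comb a _.
set E := comb a _; set F := comb a _; set H := comb a _ => m3.
have m3' : ~~ [&& c1, c2 & c3] by case: (c1) (c2) (c3) m3 => -[] -[].
have {}m3 : ~~ meetsw3 u w z by case: (c1) (c2) (c3) m3 => -[] -[].
rewrite (addrACA _ A _ B) (addrACA _ (A + B) _ C) (addrACA _ (A + B + C) _ D).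
rewrite (addrACA _ E _ F) (addrACA _ (E + F) _ H) -!mulrnDr (IH u w z) //.
by congr (x *+ _ + _); case: (c1) (c2) (c3) m3' => -[] -[].
Qed.

End WordSums.

Lemma comb_unitl (G : finZmodType) (b : seq G) : size b = 4 -> map (comb b) unitl = b.
Proof.
case: b => [|x0 [|x1 [|x2 [|x3 [|? ?]]]]] // _; rewrite /= !comb_cons comb_nil.
by rewrite !mulr0n !mulr1n !add0r !addr0.
Qed.

Section Code.
Variable G : finZmodType.
Implicit Types (a b : seq G).

Lemma code_sound b ls t w : all (fun x => x *+ 2 == 0) b ->
    all (fun l => size l == size b) ls -> size t = size b -> w \in code ls t ->
  size w = (size ls + size b)%N /\ comb (map (comb b) ls ++ b) w = comb b t.
Proof.
move=> b2; elim: ls t w => [|l ls IH] t w /=.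
  by move=> _ sz; rewrite inE => /eqP->; rewrite sz.
case/andP=> /eqP szl szls szt; rewrite mem_cat => /orP[] /mapP[u uc ->] /=.
  by rewrite comb_cons add0r; have [-> ->] := IH _ _ szls szt uc.
rewrite comb_cons; have [|-> ->] := IH _ _ szls _ uc.
  by rewrite size_addw ?szl.
rewrite comb_addw // addrA -mulr2n; split=> //.
by rewrite -[RHS]add0r; congr (_ + _); apply/eqP/(allP (span_inV b2))/spanP; exists l.
Qed.

End Code.

Section GoodWords.
Variables (n : nat) (G : finZmodType).
Hypothesis ctx : elementary_by_odd n G.
Implicit Types (p a b : seq G) (x y g : G).
Local Notation inC := (@odd_torsion n G).
Let odd_n := ebo_odd ctx.
Let cardC := ebo_cardC ctx.

Definition good_word a w := [&& size w == size a, has id w & inC (comb a w)].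

Lemma labelled_relations b ls a : labelled n b (ls ++ unitl) a ->
  {in relations ls, forall w, good_word a w}.
Proof.
case=> sz_b b2 szls E w; rewrite mem_filter => /andP[w0 wc].
have sz_a : size a = (size ls + size b)%N.
  by rewrite -(size_map (fun x => x *+ n)) E size_map size_cat sz_b.
have [||] := code_sound b2 _ _ wc; rewrite ?sz_b //.
  by move: szls; rewrite all_cat => /andP[].
move=> szw cw; rewrite /good_word w0 szw sz_a sz_b eqxx /=.
suff: comb [seq x *+ n | x <- a] w = 0.
  by rewrite /comb -map_mask big_map sumrMnl => /eqP.
by rewrite E map_cat comb_unitl // cw comb0.
Qed.

Lemma blocks_words a ws : all (good_word a) ws -> pairwise disjw ws ->
  blocks n a (map elems ws).
Proof. by move=> gw pw; apply: words_blocks. Qed.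

Lemma block_sum_elems a w : good_word a w -> block_sum a (elems w) = comb a w.
Proof. by case/and3P=> /eqP sz _ _; rewrite comb_elems. Qed.

Section Fixed.
Variables (p a : seq G) (C : seq bitseq).
Hypothesis zf : zero_sum_free (p ++ a).
Hypothesis pC : all inC p.
Hypothesis Cgood : {in C, forall w, good_word a w}.

Lemma three_disjoint_bound : three_disjoint C -> (size p + 3 < n)%N.
Proof.
rewrite /three_disjoint someE => /hasP[c1 c1C]; rewrite someE => /hasP[c2 c2C].
case: ifP => // d12; rewrite someE => /hasP[c3 c3C]; case: ifP => // d13 d23.
apply: (blocks_size cardC zf pC (P := map elems [:: c1; c2; c3])).
apply: blocks_words; first by rewrite /= !Cgood.
by rewrite /= !disjwE d12 d13 d23.
Qed.

Lemma disjoint_pair_eq c d : (size p + 2).+1 = n ->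
  good_word a c -> good_word a d -> ~~ meetsw c d -> comb a c = comb a d.
Proof.
move=> sz gc gd dis; rewrite -!block_sum_elems //.
apply: (blocks_const cardC zf pC (P := map elems [:: c; d])) => //.
- by apply: blocks_words; rewrite /= ?gc ?gd // disjwE dis.
- by rewrite mem_cat inE eqxx orbT.
- by rewrite mem_cat !inE eqxx !orbT.
Qed.

Lemma good_word_neq0 c : good_word a c -> comb a c != 0.
Proof.
move=> gc; have bl : blocks n a (map elems [:: c]).
  by apply: blocks_words; rewrite /= ?gc.
have := blocks_zero_sum_free bl zf; rewrite /= block_sum_elems // => zf1.
rewrite -(big_seq1 (@GRing.add _) (comb a c) id).
by apply: (zero_sum_free_sum_neq0 (R := p) zf1); rewrite // perm_catC.
Qed.

(** The word c and its complement c' in the disjoint union of h and d are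
    disjoint as well, so that their sums coincide; twice this sum is the sum over
    the union, which is twice the sum over h. *)
Lemma linked_eq h c : (size p + 2).+1 = n -> h \in C -> c \in linked C h ->
  comb a c = comb a h.
Proof.
move=> sz hC; rewrite mem_filter someE => /andP[/hasP[u uU su] cC].
have /mapP[d] := uU; rewrite mem_filter => /andP[dis dC] Eu.
move: su; rewrite {u uU}Eu; case: ifP => // sub neq.
have [[gh gd] gc] := (Cgood hC, Cgood dC, Cgood cC).
have [/and3P[/eqP szh _ hT] /and3P[/eqP szd _ dT] /and3P[/eqP szc _ cT]] := And3 gh gd gc.
have szu : size (orw h d) = size a by rewrite size_orw ?szh.
have [dis' sum' /(_ _)] := subw_split szc szu sub.
set c' := addw c _ in dis' sum' *; move=> c'0.
have sum : comb a c + comb a c' = comb a h + comb a d by rewrite -sum' comb_orw.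
have Ehd := disjoint_pair_eq sz gh gd dis.
have c'T : inC (comb a c').
  have -> : comb a c' = comb a h + comb a d - comb a c by rewrite -sum addrC addKr.
  rewrite /odd_torsion mulrnBl mulrnDl (eqP hT) (eqP dT) (eqP cT).
  by rewrite addr0 subr0.
have gc' : good_word a c'.
  rewrite /good_word c'T c'0 ?size_addw ?szc ?eqxx ?szu //.
  by apply: contraNneq neq => ->; apply/eqwP.
have Ecc' := disjoint_pair_eq sz gc gc' dis'.
apply: (odd_torsion_double_inj odd_n) => //.
by rewrite !mulr2n {2}Ecc' sum -Ehd.
Qed.

(** With seven equal sums g the identity of [comb_triple] reads 4 g = 3 g. *)
Lemma dependent_triple_eq0 D g : {in D, forall c, size c = size a /\ comb a c = g} ->
  dependent_triple D -> g = 0.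
Proof.
move=> Dg; rewrite /dependent_triple someE => /hasP[c1 c1D].
rewrite someE => /hasP[c2 c2D]; case: ifP => //; rewrite memwE => c12.
rewrite someE => /hasP[c3 c3D]; case: ifP => // m3; case: ifP => //.
rewrite memwE => c13; case: ifP => //; rewrite !memwE => c23 c123.
have [[s1 E1] [s2 E2] [s3 E3]] := And3 (Dg _ c1D) (Dg _ c2D) (Dg _ c3D).
have := comb_triple s1 s2 s3 (negbT m3).
rewrite E1 E2 E3 (Dg _ c12).2 (Dg _ c13).2 (Dg _ c23).2 (Dg _ c123).2.
by rewrite -[X in _ = X]addr0 => /addrI.
Qed.

End Fixed.

Lemma comb_cube b w o h2 h3 : all (fun x => x *+ 2 == 0) b -> size b = 4 ->
    all (fun l => size l == 4) [:: w; o; h2; h3] ->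
  map (comb [:: comb b o; comb b w; comb b h2; comb b h3]) cube_labels =
  map (comb b) (w :: cube o w h2 h3).
Proof.
move=> b2 sz_b /and5P[/eqP sw /eqP so /eqP s2 /eqP s3 _].
rewrite /cube_labels /cube /= !comb_cons !comb_nil.
rewrite !(mulr0n, mulr1n, add0r, addr0).
rewrite !comb_addw ?size_addw ?so ?sw ?s2 ?s3 ?sz_b // ?addr0.
congr [:: _; _; _; _; _; _; _; _; _];
  by rewrite ?(addrC (comb b o)) -?addrA ?addr0 ?add0r.
Qed.

End GoodWords.

(** * Nine distinct values *)

Section NineDistinct.
Variables (n : nat) (G : finZmodType).
Hypothesis ctx : elementary_by_odd n G.
Implicit Types (p a b : seq G) (x y g : G).
Local Notation inC := (@odd_torsion n G).
Let cardV := ebo_cardV ctx.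

Lemma uniq_comb b ls : independent b -> all (fun l => size l == size b) ls ->
  uniq (map (comb b) ls) = uniq ls.
Proof.
move=> ib szls; apply: map_inj_in_uniq => u w /(allP szls)/eqP su /(allP szls)/eqP sw.
exact: comb_inj.
Qed.

Lemma perm_labels b (A : seq G) (L : seq bitseq) : independent b -> size b = 4 ->
    all (fun x => x *+ 2 == 0) A -> uniq A -> perm_eq (words 4) L ->
  perm_eq A (map (comb b) [seq l <- L | comb b l \in A]).
Proof.
move=> ib sz_b AV uA pL; apply: uniq_perm => // [|x].
  rewrite uniq_comb ?filter_uniq -?(perm_uniq pL) ?uniq_words //.
  by apply/allP => l; rewrite mem_filter -(perm_mem pL) mem_words sz_b => /andP[].
apply/idP/mapP => [xA | [l + ->]]; last by rewrite mem_filter => /andP[].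
have /spanP[l sz_l xl] := independent_full cardV ib sz_b (allP AV x xA).
exists l => //; rewrite mem_filter -xl xA -(perm_mem pL) mem_words sz_l sz_b.
by [].
Qed.

Lemma arrange_perm a (L : seq G) : uniq [seq x *+ n | x <- a] ->
    perm_eq [seq x *+ n | x <- a] L ->
  exists2 a', perm_eq a a' & [seq x *+ n | x <- a'] = L.
Proof.
move=> ua pL; have [||a' [r [pa E]]] := arrange ua (L := L).
- by rewrite -(perm_uniq pL).
- by move=> x; rewrite (perm_mem pL).
exists a' => //; suff r0 : r = [::] by rewrite r0 cats0 in pa.
apply/nilP; rewrite /nilp; have := perm_size pa.
rewrite size_cat -(size_map (fun x => x *+ n) a') E -(perm_size pL) size_map.
by move=> /eqP; rewrite -[X in X == _]addn0 eqn_add2l eq_sym.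
Qed.

(** A basis among the nine values gives them labels, and the finite verification
    leaves three cases: three disjoint blocks are too many; a dependent triple
    among blocks of equal sum is absurd; and the eight points of an affine
    hyperplane with one direction are excluded by [no_cube]. *)
Theorem nine_distinct p a :
    all inC p -> (size p).+3 = n -> size a = 9 -> uniq [seq x *+ n | x <- a] ->
  ~ zero_sum_free (p ++ a).
Proof.
move=> pC sz_p sz_a ua zf; set A := [seq x *+ n | x <- a] in ua.
have AV : all (fun x => x *+ 2 == 0) A := all_V ctx a.
have [|b sz_b [ib bA]] := @independent_in G A 4 AV ua; first by rewrite size_map sz_a.
have b2 : all (fun x => x *+ 2 == 0) b by case/andP: ib.
pose m := [seq comb b l \in A | l <- nonunitl].
pose rest := mask m nonunitl.
have pA : perm_eq A (map (comb b) (rest ++ unitl)).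
  apply: perm_trans (perm_labels ib sz_b AV ua perm_words4) _.
  rewrite filter_cat filter_mask [X in _ ++ X](_ : _ = unitl) //.
  apply/all_filterP/allP => l lU; apply: bA.
  by have := map_f (comb b) lU; rewrite comb_unitl.
have sz_rest : size rest = 5.
  have := perm_size pA; rewrite !size_map sz_a size_cat addnC.
  by move=> /(@addnI 4 5)/esym.
have [a' pa a'V] := arrange_perm ua pA.
have {}zf : zero_sum_free (p ++ a').
  by apply: perm_zero_sum_free zf; rewrite perm_cat2l.
have szU : all (fun l : bitseq => size l == 4) (rest ++ unitl).
  rewrite all_cat andbT; apply/allP => l /mem_mask.
  by move: l; apply/allP.
have lab : labelled n b (rest ++ unitl) a' by split.
have Cgood := labelled_relations lab.
have : check9 rest.
  have /allP/(_ m) := check9P; rewrite mem_words size_map => /(_ isT).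
  by rewrite -(@size_mask _ m nonunitl) ?size_map // -/rest sz_rest.
rewrite /check9; case: ifP => [/(three_disjoint_bound ctx zf pC Cgood)|_].
  by rewrite -sz_p addn3 ltnn.
case: ifP => [|_].
  rewrite someE => /hasP[h hC] dep; have /eqP[] := good_word_neq0 zf (Cgood h hC).
  apply: dependent_triple_eq0 dep => c cL.
  split; last by apply: (linked_eq ctx zf pC Cgood) => //; rewrite -sz_p addn2.
  by move: cL; rewrite mem_filter => /andP[_ /Cgood/and3P[/eqP]].
rewrite /cube_and_direction !someE => /hasP[w wL]; rewrite someE => /hasP[o oL].
rewrite someE => /hasP[o2 o2L]; rewrite someE => /hasP[o3 o3L].
case: ifP => // sub uc; set h2 := addw o o2 in sub uc; set h3 := addw o o3 in sub uc.
have sz4 l : l \in rest ++ unitl -> size l = 4 by move=> /(allP szU)/eqP.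
have szc : all (fun l : bitseq => size l == 4) [:: w; o; h2; h3].
  by rewrite /= /h2 /h3 !size_addw !sz4.
have E := comb_cube b2 sz_b szc.
have [|||a'' [r [pa'' a''V]]] := arrange (n := n) (a := a')
  (L := map (comb b) (w :: cube o w h2 h3)).
- by rewrite a'V -(perm_uniq pA).
- rewrite uniq_comb // sz_b; apply/allP => l /(allP sub)/sz4->//.
- by move=> _ /mapP[l /(allP sub) lL ->]; rewrite a'V map_f.
apply: (no_cube ctx (a := a'') _ pC sz_p (b := [:: comb b o; comb b w; comb b h2; comb b h3])).
  split=> //; last by rewrite a''V E.
  apply/allP => x; rewrite !inE => xb; apply: (allP (span_inV b2)); apply/spanP.
  case/and5P: szc => /eqP sw /eqP so /eqP s2 /eqP s3 _.
  by case/or4P: xb => /eqP->; [exists o | exists w | exists h2 | exists h3]; rewrite ?sz_b.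
exact: zero_sum_free_perm_catl pa'' zf.
Qed.
End NineDistinct.

(** * Twelve and eleven given values *)

(** Big-endian binary digits. Elements of order at most 2 are now written as
    numbers below 16, which add by bitwise exclusive or. *)
Definition bits (v : nat) : bitseq := [:: odd v./2./2./2; odd v./2./2; odd v./2; odd v].

Fact pt_key : unit. Proof. exact: tt. Qed.

Section Explicit.
Variables (n : nat) (G : finZmodType).
Hypothesis ctx : elementary_by_odd n G.
Implicit Types (p a b : seq G) (x y g : G) (B : seq nat) (P Q : seq (seq nat)).
Local Notation inC := (@odd_torsion n G).
Let odd_n := ebo_odd ctx.
Let n_gt2 := ebo_gt2 ctx.
Let cardC := ebo_cardC ctx.

Section Points.
Variables (vals : seq nat) (p a b : seq G).
Hypothesis lab : labelled n b (map bits vals) a.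
Hypothesis zf : zero_sum_free (p ++ a).
Hypothesis pC : all inC p.

(** Blocks are given by the values of their terms instead of the positions. *)
Definition positions P := [seq [seq index v vals | v <- B] | B <- P].
Definition packs P := packing (map bits vals) (positions P).
(** Locked, so that comparing two points does not unfold the search for their
    positions. *)
Definition pt : nat -> G := locked_with pt_key (fun v => a`_(index v vals)).
Definition bsum B : G := \sum_(v <- B) pt v.

Lemma bsumE B : block_sum a [seq index v vals | v <- B] = bsum B.
Proof.
by rewrite /block_sum big_map; apply: eq_bigr => v _; rewrite /pt unlock.
Qed.

Lemma bsum_positions P : map (block_sum a) (positions P) = map bsum P.
Proof. by rewrite -map_comp; apply: eq_map => B; apply: bsumE. Qed.

Lemma bsum_perm P Q : perm_eq (flatten P) (flatten Q) ->
  \sum_(B <- P) bsum B = \sum_(B <- Q) bsum B.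
Proof. by move=> pPQ; rewrite /bsum -!big_flatten; apply: perm_big. Qed.

Lemma packs_full P B : packs P -> (size p + size P).+1 = n -> B \in P ->
  [/\ saturating n (bsum B), p = nseq (size p) (bsum B)
    & {in P, forall B', bsum B' = bsum B}].
Proof.
move=> PP sz BP; rewrite -bsumE.
have [||sat pE E] := full_packing (B := [seq index v vals | v <- B]) ctx lab zf pC PP.
- by rewrite size_map.
- exact: map_f.
by split=> // B' B'P; rewrite -bsumE; apply/E/map_f.
Qed.

Lemma packs_torsion B : packs [:: B] -> inC (bsum B).
Proof. by move=> PB; rewrite -bsumE; apply: packing_torsion lab PB. Qed.

Lemma packs_neq0 B : packs [:: B] -> bsum B != 0.
Proof.
move=> PB; have := blocks_zero_sum_free (packing_blocks lab PB) zf.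
rewrite /= bsumE => zf1; rewrite -(big_seq1 (@GRing.add _) (bsum B) id).
by apply: (zero_sum_free_sum_neq0 (R := p) zf1); rewrite // perm_catC.
Qed.

Lemma packs_range P B g d : packs (B :: P) -> saturating n g ->
    p = nseq (size p) g -> {in P, forall B', bsum B' = g} ->
    (size p + size P + d).+1 = n ->
  exists2 t, (0 < t <= d)%N & bsum B = g *+ t.
Proof.
move=> PB sat pg Pg sz; have bl := packing_blocks lab PB.
have lt_d : (d < n)%N by rewrite -sz ltnS leq_addl.
have := blocks_torsion bl; rewrite bsum_positions /= => /andP[BC _].
apply: (saturating_range odd_n cardC sat BC lt_d).
suff -> : nseq (n.-1 - d) g = p ++ map bsum P.
  have := blocks_zero_sum_free bl zf; rewrite bsum_positions.
  by apply: perm_zero_sum_free; rewrite -catA perm_cat2l cats1 perm_sym perm_rcons.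
have sz_n : (n.-1 - d = size (p ++ map bsum P))%N.
  by rewrite size_cat size_map -sz /= addnK.
rewrite sz_n; apply/esym/const_seq => y; rewrite mem_cat => /orP[|/mapP[B' + ->]].
  by rewrite pg => /nseqP[].
exact: Pg.
Qed.

End Points.

Lemma saturating_absurd g t k : saturating n g -> g *+ (t + k) = g *+ t ->
  (0 < k < n)%N -> False.
Proof.
move=> sat E k_n; have /eqP[] := saturating_neq0 odd_n cardC sat k_n.
by apply: (addrI (g *+ t)); rewrite -mulrnDr addr0.
Qed.

(** With L = {0, 1, 2, 3} as a group of order 4, the values 4 + i, 8 + i and
    12 + i form the three nontrivial cosets of L, and the lines meeting all
    three are the sets {4 + i, 8 + j, 12 + (i xor j)}. Each of the following
    four families comes from multiplication by a primitive element of the field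
    on L and partitions the cosets into lines. *)
Definition spread0 : seq (seq nat) :=
  [:: [:: 4; 8; 12]; [:: 5; 10; 15]; [:: 6; 11; 13]; [:: 7; 9; 14]]%N.
Definition spread1 : seq (seq nat) :=
  [:: [:: 4; 9; 13]; [:: 5; 11; 14]; [:: 6; 10; 12]; [:: 7; 8; 15]]%N.
Definition spread2 : seq (seq nat) :=
  [:: [:: 4; 10; 14]; [:: 5; 8; 13]; [:: 6; 9; 15]; [:: 7; 11; 12]]%N.
Definition spread3 : seq (seq nat) :=
  [:: [:: 4; 11; 15]; [:: 5; 9; 12]; [:: 6; 8; 14]; [:: 7; 10; 13]]%N.
(** The conjugate family shares one line with each of the other four. *)
Definition spread_conj : seq (seq nat) :=
  [:: [:: 4; 8; 12]; [:: 5; 11; 14]; [:: 6; 9; 15]; [:: 7; 10; 13]]%N.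

Lemma pt_torsion vals a v : inC (pt vals a v *+ 2).
Proof. by rewrite /odd_torsion mulrnAC (ebo_exp ctx). Qed.

Lemma add_three_of x y z w : x + y + z = w -> x + (x + (x + (y + z))) = w + x *+ 2.
Proof.
by move=> <-; rewrite -(addrA x y) mulr2n (addrA x x) (addrC (x + x)).
Qed.

(** Each spread is a full packing, and the conjugate one shares a line with each
    of the four others, so that all sixteen lines have the same sum g. Comparing
    lines shows that the points of a coset have equal doubles, say X, Y, Z for the
    three cosets, with X + Y + Z = 2 g. But each of X, Y, Z is g or 2 g: the four
    points of a coset form a block of sum 2 X, which is not 0, and three points of
    a coset with one of each other coset form a block with sum g, 2 g or 3 g. *)
Lemma no_twelve p a b :
    labelled n b (map bits (iota 4 12)) a -> all inC p -> (size p + 5)%N = n ->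
  ~ zero_sum_free (p ++ a).
Proof.
move=> lab pC sz_p zf; set F := bsum (iota 4 12) a; set x := pt (iota 4 12) a.
have full P B : packs (iota 4 12) P -> size P = 4 -> B \in P ->
    [/\ saturating n (F B), p = nseq (size p) (F B) & {in P, forall B', F B' = F B}].
  by move=> PP szP BP; apply: (packs_full lab zf pC) => //; rewrite szP -addnS.
pose g := F [:: 4; 8; 12]%N.
have [sat pg Ec] := full spread_conj _ isT erefl (mem_head _ _).
have line_g B : B \in spread0 ++ spread1 ++ spread2 ++ spread3 -> F B = g.
  rewrite !mem_cat => /or4P[] BP.
  - by have [_ _ ->] := full spread0 [:: 4; 8; 12]%N isT erefl isT.
  - by have [_ _ ->] := full spread1 [:: 5; 11; 14]%N isT erefl isT; rewrite ?Ec.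
  - by have [_ _ ->] := full spread2 [:: 6; 9; 15]%N isT erefl isT; rewrite ?Ec.
  - by have [_ _ ->] := full spread3 [:: 7; 10; 13]%N isT erefl isT; rewrite ?Ec.
have doubles u v c1 c2 c3 c4 :
    [&& c1 \in spread0 ++ spread1 ++ spread2 ++ spread3,
        c2 \in spread0 ++ spread1 ++ spread2 ++ spread3,
        c3 \in spread0 ++ spread1 ++ spread2 ++ spread3,
        c4 \in spread0 ++ spread1 ++ spread2 ++ spread3
      & perm_eq (c1 ++ c2 ++ [:: u; u]) (c3 ++ c4 ++ [:: v; v])] ->
    x u *+ 2 = x v *+ 2.
  case/and5P=> h1 h2 h3 h4 pc.
  have := @bsum_perm (iota 4 12) a [:: c1; c2; [:: u]; [:: u]] [:: c3; c4; [:: v]; [:: v]] pc.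
  rewrite !big_cons !big_nil !addr0 -/F.
  rewrite (line_g _ h1) (line_g _ h2) (line_g _ h3) (line_g _ h4) => /addrI/addrI.
  by rewrite /F /bsum !big_seq1 -/x !mulr2n.
have dx v : v \in [:: 4; 5; 6; 7]%N -> x v *+ 2 = x 4%N *+ 2.
  rewrite !inE => /or4P[] /eqP->; first by [].
  - by apply: (doubles _ _ [:: 4; 8; 12] [:: 4; 9; 13] [:: 5; 8; 13] [:: 5; 9; 12])%N.
  - by apply: (doubles _ _ [:: 4; 8; 12] [:: 4; 10; 14] [:: 6; 8; 14] [:: 6; 10; 12])%N.
  - by apply: (doubles _ _ [:: 4; 8; 12] [:: 4; 11; 15] [:: 7; 8; 15] [:: 7; 11; 12])%N.
have dy v : v \in [:: 8; 9; 10; 11]%N -> x v *+ 2 = x 8%N *+ 2.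
  rewrite !inE => /or4P[] /eqP->; first by [].
  - by apply: (doubles _ _ [:: 4; 8; 12] [:: 5; 8; 13] [:: 4; 9; 13] [:: 5; 9; 12])%N.
  - by apply: (doubles _ _ [:: 4; 8; 12] [:: 6; 8; 14] [:: 4; 10; 14] [:: 6; 10; 12])%N.
  - by apply: (doubles _ _ [:: 4; 8; 12] [:: 7; 8; 15] [:: 4; 11; 15] [:: 7; 11; 12])%N.
have dz v : v \in [:: 12; 13; 14; 15]%N -> x v *+ 2 = x 12%N *+ 2.
  rewrite !inE => /or4P[] /eqP->; first by [].
  - by apply: (doubles _ _ [:: 4; 8; 12] [:: 5; 9; 12] [:: 4; 9; 13] [:: 5; 8; 13])%N.
  - by apply: (doubles _ _ [:: 4; 8; 12] [:: 6; 10; 12] [:: 4; 10; 14] [:: 6; 8; 14])%N.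
  - by apply: (doubles _ _ [:: 4; 8; 12] [:: 7; 11; 12] [:: 4; 11; 15] [:: 7; 8; 15])%N.
have double_F B : F B *+ 2 = \sum_(v <- B) x v *+ 2 by rewrite /F /bsum sumrMnl.
have sum_g : x 4%N *+ 2 + x 8%N *+ 2 + x 12%N *+ 2 = g *+ 2.
  by rewrite /g double_F !big_cons big_nil addr0 [RHS]addrA.
(* A block of five points, three of them in one coset, leaves a line of the
   spread, so that its sum is at most 3 g. *)
have coset u B4 B5 L : packs (iota 4 12) [:: B4] -> size B4 = 4 ->
    {in B4, forall v, x v *+ 2 = x u *+ 2} ->
    packs (iota 4 12) [:: B5; L] -> L \in spread0 ++ spread1 ++ spread2 ++ spread3 ->
    F B5 *+ 2 = g *+ 2 + x u *+ 2 *+ 2 ->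
  exists2 t, (0 < t <= 2)%N & x u *+ 2 = g *+ t.
  move=> P4 sz4 d4 P5 Lg E5.
  have [||t /andP[t_gt0 le_t3] Et] := packs_range (d := 3%N) lab zf P5 sat pg.
  - by move=> B'; rewrite inE => /eqP->; apply: line_g.
  - by rewrite -sz_p /=; lia.
  have ut : x u *+ 2 = g *+ t.-1.
    apply: (odd_torsion_double_inj odd_n); first exact: pt_torsion.
      exact/odd_torsionMn/saturating_torsion.
    apply: (addrI (g *+ 2)); rewrite -E5 /F Et -!mulrnA -mulrnDr.
    by congr (_ *+ _); lia.
  exists t.-1 => //; apply/andP; split; last by lia.
  rewrite lt0n; apply/eqP => t0; have /eqP[] := packs_neq0 lab zf P4.
  apply: (odd_torsion_double_eq0 odd_n (packs_torsion lab P4)).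
  rewrite -/F double_F big_seq_cond (eq_bigr (fun _ => 0)) ?big1 //.
  by move=> v /andP[/d4-> _]; rewrite ut t0.
have [|t1 h1 E1] := coset 4%N [:: 4; 5; 6; 7]%N [:: 4; 5; 6; 8; 15]%N [:: 7; 10; 13]%N
    isT erefl dx isT isT.
  rewrite double_F !big_cons big_nil addr0 (dx 5%N isT) (dx 6%N isT) (dz 15%N isT).
  exact: add_three_of.
have [|t2 h2 E2] := coset 8%N [:: 8; 9; 10; 11]%N [:: 8; 9; 10; 4; 15]%N [:: 5; 11; 14]%N
    isT erefl dy isT isT.
  rewrite double_F !big_cons big_nil addr0 (dy 9%N isT) (dy 10%N isT) (dz 15%N isT).
  by apply: add_three_of; rewrite (addrC (x 8%N *+ 2)).
have [|t3 h3 E3] := coset 12%N [:: 12; 13; 14; 15]%N [:: 12; 13; 14; 4; 11]%N [:: 5; 10; 15]%N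
    isT erefl dz isT isT.
  rewrite double_F !big_cons big_nil addr0 (dz 13%N isT) (dz 14%N isT) (dy 11%N isT).
  by apply: add_three_of; rewrite (addrC (x 12%N *+ 2)) addrAC.
apply: (saturating_absurd (t := 2%N) (k := (t1 + t2 + t3 - 2)%N) sat).
  by rewrite -sum_g E1 E2 E3 -!mulrnDr; congr (_ *+ _); lia.
by rewrite -sz_p; lia.
Qed.

(** Without the value 4 each spread keeps three lines, and the argument of
    [no_twelve] still gives Y = Z = g for the complete cosets. Their eight points
    form a block of sum 4 g, which exceeds the three sums that are possible. *)
Lemma no_eleven_coset p a b :
    labelled n b (map bits (iota 5 11)) a -> all inC p -> (size p + 4)%N = n ->
  ~ zero_sum_free (p ++ a).
Proof.
move=> lab pC sz_p zf; set F := bsum (iota 5 11) a; set x := pt (iota 5 11) a.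
have p_gt0 : (0 < size p)%N.
  by rewrite lt0n; apply: contraTneq odd_n => p0; rewrite -sz_p p0.
pose g := head 0 p.
have full P B : packs (iota 5 11) P -> size P = 3 -> B \in P ->
    saturating n (F B) /\ F B = g.
  move=> PP szP BP; have [|sat pE _] := packs_full lab zf pC PP _ BP.
    by rewrite szP -addnS.
  by split=> //; rewrite /g pE; case: (size p) p_gt0.
pose lines := behead spread0 ++ behead spread1 ++ behead spread2 ++ behead spread3.
have line_g B : B \in lines -> F B = g.
  rewrite !mem_cat => /or4P[] BP.
  - by have [_ ->] := full (behead spread0) B isT erefl BP.
  - by have [_ ->] := full (behead spread1) B isT erefl BP.
  - by have [_ ->] := full (behead spread2) B isT erefl BP.
  - by have [_ ->] := full (behead spread3) B isT erefl BP.
have sat : saturating n g.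
  by have [sB <-] := full (behead spread0) _ isT erefl (mem_head _ _).
have pg : p = nseq (size p) g.
  have [|_ pE _] := packs_full (P := behead spread0) (B := [:: 5; 10; 15]%N) lab zf pC isT _ isT.
    by rewrite -addnS.
  by rewrite {1}pE -/F line_g.
have doubles u v c1 c2 c3 c4 :
    [&& c1 \in lines, c2 \in lines, c3 \in lines, c4 \in lines
      & perm_eq (c1 ++ c2 ++ [:: u; u]) (c3 ++ c4 ++ [:: v; v])] ->
    x u *+ 2 = x v *+ 2.
  case/and5P=> h1 h2 h3 h4 pc.
  have := @bsum_perm (iota 5 11) a [:: c1; c2; [:: u]; [:: u]] [:: c3; c4; [:: v]; [:: v]] pc.
  rewrite !big_cons !big_nil !addr0 -/F.
  rewrite (line_g _ h1) (line_g _ h2) (line_g _ h3) (line_g _ h4) => /addrI/addrI.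
  by rewrite /F /bsum !big_seq1 -/x !mulr2n.
have dx v : v \in [:: 5; 6; 7]%N -> x v *+ 2 = x 5%N *+ 2.
  rewrite !inE => /or3P[] /eqP->; first by [].
  - by apply: (doubles _ _ [:: 5; 8; 13] [:: 5; 11; 14] [:: 6; 8; 14] [:: 6; 11; 13])%N.
  - by apply: (doubles _ _ [:: 5; 8; 13] [:: 5; 10; 15] [:: 7; 8; 15] [:: 7; 10; 13])%N.
have dy v : v \in [:: 8; 9; 10; 11]%N -> x v *+ 2 = x 8%N *+ 2.
  rewrite !inE => /or4P[] /eqP->; first by [].
  - by apply: (doubles _ _ [:: 6; 8; 14] [:: 7; 8; 15] [:: 6; 9; 15] [:: 7; 9; 14])%N.
  - by apply: (doubles _ _ [:: 5; 8; 13] [:: 7; 8; 15] [:: 5; 10; 15] [:: 7; 10; 13])%N.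
  - by apply: (doubles _ _ [:: 5; 8; 13] [:: 6; 8; 14] [:: 5; 11; 14] [:: 6; 11; 13])%N.
have dz v : v \in [:: 12; 13; 14; 15]%N -> x v *+ 2 = x 12%N *+ 2.
  rewrite !inE => /or4P[] /eqP->; first by [].
  - by apply: (doubles _ _ [:: 6; 10; 12] [:: 7; 11; 12] [:: 6; 11; 13] [:: 7; 10; 13])%N.
  - by apply: (doubles _ _ [:: 5; 9; 12] [:: 7; 11; 12] [:: 5; 11; 14] [:: 7; 9; 14])%N.
  - by apply: (doubles _ _ [:: 5; 9; 12] [:: 6; 10; 12] [:: 5; 10; 15] [:: 6; 9; 15])%N.
have double_F B : F B *+ 2 = \sum_(v <- B) x v *+ 2 by rewrite /F /bsum sumrMnl.
have sum_g : x 5%N *+ 2 + x 8%N *+ 2 + x 12%N *+ 2 = g *+ 2.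
  by rewrite -(line_g [:: 5; 8; 13]%N isT) double_F !big_cons big_nil addr0 (dz 13%N isT) [RHS]addrA.
have coset u B4 B5 L : packs (iota 5 11) [:: B4] ->
    {in B4, forall v, x v *+ 2 = x u *+ 2} ->
    packs (iota 5 11) [:: B5; L] -> L \in lines ->
    F B5 *+ 2 = g *+ 2 + x u *+ 2 *+ 2 -> x u *+ 2 = g.
  move=> P4 d4 P5 Lg E5.
  have [||t /andP[t_gt0 le_t2] Et] := packs_range (d := 2%N) lab zf P5 sat pg.
  - by move=> B'; rewrite inE => /eqP->; apply: line_g.
  - by rewrite -sz_p /=; lia.
  have ut : x u *+ 2 = g *+ t.-1.
    apply: (odd_torsion_double_inj odd_n); first exact: pt_torsion.
      exact/odd_torsionMn/saturating_torsion.
    apply: (addrI (g *+ 2)); rewrite -E5 /F Et -!mulrnA -mulrnDr.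
    by congr (_ *+ _); lia.
  case: t t_gt0 le_t2 {Et} ut => [|[|[|t]]] // _ _ /=.
  rewrite mulr0n => u0; have /eqP[] := packs_neq0 lab zf P4.
  apply: (odd_torsion_double_eq0 odd_n (packs_torsion lab P4)).
  rewrite -/F double_F big_seq_cond (eq_bigr (fun _ => 0)) ?big1 //.
  by move=> v /andP[/d4-> _].
have E2 : x 8%N *+ 2 = g.
  apply: (coset _ [:: 8; 9; 10; 11]%N [:: 8; 9; 10; 5; 14]%N [:: 6; 11; 13]%N) => //.
  rewrite double_F !big_cons big_nil addr0 (dy 9%N isT) (dy 10%N isT) (dz 14%N isT).
  by apply: add_three_of; rewrite (addrC (x 8%N *+ 2)).
have E3 : x 12%N *+ 2 = g.
  apply: (coset _ [:: 12; 13; 14; 15]%N [:: 12; 13; 14; 5; 10]%N [:: 6; 9; 15]%N) => //.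
  rewrite double_F !big_cons big_nil addr0 (dz 13%N isT) (dz 14%N isT) (dy 10%N isT).
  by apply: add_three_of; rewrite (addrC (x 12%N *+ 2)) addrAC.
have P8 : packs (iota 5 11) [:: iota 8 8] by [].
have [||t /andP[t_gt0 le_t3] Et] := packs_range (d := 3%N) lab zf P8 sat pg.
- by [].
- by rewrite -sz_p /=; lia.
have E8 : F (iota 8 8) = g *+ 4.
  apply: (odd_torsion_double_inj odd_n (packs_torsion lab P8)).
    exact/odd_torsionMn/saturating_torsion.
  rewrite double_F !big_cons big_nil addr0 (dy 9%N isT) (dy 10%N isT) (dy 11%N isT).
  rewrite (dz 13%N isT) (dz 14%N isT) (dz 15%N isT) E2 E3 -mulrnA.
  by rewrite !(addrA, =^~ mulrSr, =^~ mulr2n).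
apply: (saturating_absurd (t := t) (k := (4 - t)%N) sat); last by rewrite -sz_p; lia.
by rewrite -Et -/F E8; congr (_ *+ _); lia.
Qed.

(** The first member of each triple of disjoint blocks has sum g. Those of [Ps]
    cover the same points as those of [Qs], which are one fewer, so that g = 0.
    The two applications below are instances of the identity of [comb_triple]. *)
Lemma no_eleven_relation vals Ps Qs p a b :
    labelled n b (map bits vals) a -> all inC p -> (size p + 4)%N = n ->
    all (fun P => packs vals P && (size P == 3)) (Ps ++ Qs) ->
    size Ps = (size Qs).+1 ->
    perm_eq (flatten (map (head [::]) Ps)) (flatten (map (head [::]) Qs)) ->
  ~ zero_sum_free (p ++ a).
Proof.
move=> lab pC sz_p allP szPQ pPQ zf.
have p_gt0 : (0 < size p)%N.
  by rewrite lt0n; apply: contraTneq odd_n => p0; rewrite -sz_p p0.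
pose g := head 0 p.
have full P : P \in Ps ++ Qs -> saturating n g /\ bsum vals a (head [::] P) = g.
  move=> /(seq.allP allP)/andP[PP /eqP szP].
  have [||sat pE _] := packs_full (B := head [::] P) lab zf pC PP.
  - by rewrite szP -addnS.
  - by case: P szP {PP} => // B P _; apply: mem_head.
  suff <- : bsum vals a (head [::] P) = g by [].
  by rewrite /g pE; case: (size p) p_gt0.
have sum_g R : {subset R <= Ps ++ Qs} ->
    \sum_(B <- map (head [::]) R) bsum vals a B = g *+ size R.
  move=> sR; rewrite big_map big_seq (eq_bigr (fun _ => g)); last first.
    by move=> P /sR/full[].
  by rewrite -big_seq big_const_seq count_predT iter_addr_0.
have := @bsum_perm vals a _ _ pPQ; rewrite !sum_g; first last.
- by move=> P PPs; rewrite mem_cat PPs.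
- by move=> P PQs; rewrite mem_cat PQs orbT.
rewrite szPQ mulrSr -[X in _ = X]addr0 => /addrI g0.
case: Ps szPQ full {allP pPQ sum_g} => // P Ps _ full.
have [sat _] := full P (mem_head _ _).
apply: (saturating_absurd (t := 0%N) (k := 1%N) sat); last exact: ltnW n_gt2.
by rewrite mulr1n g0.
Qed.

(** The missing nonzero values are 1, 2, 4 and 8. *)
Lemma no_eleven_independent p a b :
    labelled n b (map bits [:: 3; 5; 6; 7; 9; 10; 11; 12; 13; 14; 15]%N) a ->
    all inC p -> (size p + 4)%N = n ->
  ~ zero_sum_free (p ++ a).
Proof.
move=> lab pC sz_p; apply: (no_eleven_relation
  (Ps := [:: [:: [:: 7; 10; 13]; [:: 3; 5; 6]; [:: 9; 11; 12; 14]];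
             [:: [:: 7; 9; 14]; [:: 3; 5; 6]; [:: 10; 11; 12; 13]];
             [:: [:: 3; 13; 14]; [:: 5; 9; 12]; [:: 6; 7; 10; 11]];
             [:: [:: 3; 9; 10]; [:: 5; 11; 14]; [:: 6; 7; 12; 13]]]%N)
  (Qs := [:: [:: [:: 9; 10; 13; 14]; [:: 3; 5; 6]; [:: 7; 11; 12]];
             [:: [:: 3; 7; 10; 14]; [:: 5; 9; 12]; [:: 6; 11; 13]];
             [:: [:: 3; 7; 9; 13]; [:: 5; 11; 14]; [:: 6; 10; 12]]]%N) lab) => //.
Qed.

(** The missing nonzero values are 1, 2, 4 and 7. *)
Lemma no_eleven_planar p a b :
    labelled n b (map bits [:: 3; 5; 6; 8; 9; 10; 11; 12; 13; 14; 15]%N) a ->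
    all inC p -> (size p + 4)%N = n ->
  ~ zero_sum_free (p ++ a).
Proof.
move=> lab pC sz_p; apply: (no_eleven_relation
  (Ps := [:: [:: [:: 12; 13; 14; 15]; [:: 3; 5; 6]; [:: 8; 9; 10; 11]];
             [:: [:: 8; 11; 12; 15]; [:: 3; 5; 6]; [:: 9; 10; 13; 14]];
             [:: [:: 5; 11; 14]; [:: 3; 9; 10]; [:: 6; 8; 12; 13; 15]];
             [:: [:: 5; 8; 13]; [:: 3; 9; 10]; [:: 6; 11; 12; 14; 15]]]%N)
  (Qs := [:: [:: [:: 8; 11; 13; 14]; [:: 3; 5; 6]; [:: 9; 10; 12; 15]];
             [:: [:: 5; 11; 12; 13; 15]; [:: 3; 9; 10]; [:: 6; 8; 14]];
             [:: [:: 5; 8; 12; 14; 15]; [:: 3; 9; 10]; [:: 6; 11; 13]]]%N) lab) => //.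
Qed.

End Explicit.

(** * Eleven, thirteen and fifteen distinct values *)

Section LargeValueSets.
Variables (n : nat) (G : finZmodType).
Hypothesis ctx : elementary_by_odd n G.
Implicit Types (p a b T : seq G) (x y g : G).
Local Notation inC := (@odd_torsion n G).
Let cardV := ebo_cardV ctx.

Definition values a : seq G := [seq x *+ n | x <- a].

Definition missing a : seq G := [seq x <- enum [set x : G | x *+ 2 == 0] | x \notin 0 :: values a].

Lemma missingP a x :
  (x \in missing a) = [&& x *+ 2 == 0, x != 0 & x \notin values a].
Proof. by rewrite mem_filter mem_enum !inE negb_or andbC. Qed.

Lemma size_missing a : uniq (values a) -> 0 \notin values a ->
  (size a + size (missing a) = 15)%N.
Proof.
move=> ua a0; pose V2 := enum [set x : G | x *+ 2 == 0].
have pV : perm_eq V2 (0 :: values a ++ missing a).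
  apply: uniq_perm; first exact: enum_uniq.
    rewrite /= mem_cat negb_or a0 missingP eqxx andbF /= cat_uniq ua.
    rewrite filter_uniq ?enum_uniq // andbT; apply/hasPn => x.
    by rewrite missingP => /and3P[].
  move=> x; rewrite mem_enum !inE mem_cat missingP.
  have [->|x0] := eqVneq x 0; first by rewrite mul0rn eqxx.
  case: (boolP (x \in values a)) => [|_] /=; last by rewrite andbT.
  by move/(seq.allP (all_V ctx a)).
have := perm_size pV; rewrite -cardE cardV /= size_cat size_map.
by case.
Qed.

Lemma uniq_missing a : uniq (missing a).
Proof. by rewrite filter_uniq ?enum_uniq. Qed.

(** The terms of [a] become labelled by the complement of the coordinates
    [tv] of the values that they miss. *)
Lemma complement_labelled a b (tv vals : seq nat) :
    uniq (values a) -> 0 \notin values a -> independent b -> size b = 4 ->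
    perm_eq (missing a) (map (comb b) (map bits tv)) ->
    [seq l <- map bits (iota 0 16) | l \notin map bits (0%N :: tv)] = map bits vals ->
  exists2 a', perm_eq a a' & labelled n b (map bits vals) a'.
Proof.
move=> ua a0 ib sz_b pm Ev; have b2 : all (fun x => x *+ 2 == 0) b by case/andP: ib.
have pA : perm_eq (values a) (map (comb b) (map bits vals)).
  apply: perm_trans (perm_labels ctx ib sz_b (all_V ctx a) ua
    (L := map bits (iota 0 16)) isT) _.
  rewrite -Ev; apply/perm_map; rewrite (_ : filter _ _ =
    [seq l <- map bits (iota 0 16) | l \notin map bits (0%N :: tv)]) //.
  apply: eq_in_filter => l lI; have sz_l : size l = 4 by case/mapP: lI => v _ ->.
  have clV : comb b l *+ 2 == 0.
    by apply: (seq.allP (span_inV b2)); apply/spanP; exists l; rewrite ?sz_b.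
  have c0 : (comb b l == 0) = (l == bits 0%N).
    apply/eqP/eqP => [E|->]; last exact: (comb0 b 4).
    by apply: (comb_inj ib); rewrite ?sz_b // E (comb0 b 4).
  rewrite inE negb_or -c0; have := missingP a (comb b l).
  rewrite (perm_mem pm) clV /=; have -> : (comb b l \in map (comb b) (map bits tv)) = (l \in map bits tv).
    apply/mapP/idP => [[l' l'tv E] | ltv]; last by exists l.
    suff -> : l = l' by [].
    by apply: (comb_inj ib); rewrite ?sz_b //; case/mapP: l'tv => v _ ->.
  move=> ->; rewrite negb_and !negbK.
  by case: eqVneq => //= ->; apply/negbTE.
have [a' pa a'V] := arrange_perm ua pA.
exists a' => //; split=> //.
by apply/allP => l /mapP[v _ ->].
Qed.

Lemma independent_one x : x *+ 2 == 0 -> x != 0 -> independent [:: x].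
Proof.
by move=> x2 x0; rewrite /independent /span /= x2 /comb /= big_nil big_seq1 inE eq_sym x0.
Qed.

Lemma independent_two x y : x *+ 2 == 0 -> y *+ 2 == 0 -> x != 0 -> y != 0 -> x != y ->
  independent [:: x; y].
Proof.
move=> x2 y2 x0 y0 xy; apply: independent_cons => //; first exact: independent_one.
by rewrite /span /= /comb /= big_nil big_seq1 !inE negb_or x0.
Qed.

Lemma independent_three x y z : independent [:: y; z] -> x *+ 2 == 0 ->
  [&& x != 0, x != y, x != z & x != y + z] -> independent [:: x; y; z].
Proof.
move=> iyz x2 /and4P[x0 xy xz xyz]; apply: independent_cons => //.
rewrite /span /= /comb /= !(big_nil, big_cons) !addr0 !inE !negb_or x0 xz xy.
by rewrite xyz.
Qed.

(** A term of value 0 lies in [odd_torsion] and may join [p]. *)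
Lemma zero_value_torsion p a : 0 \in values a -> all inC p -> zero_sum_free (p ++ a) ->
    uniq (values a) ->
  exists p' a', [/\ all inC p', size p' = (size p).+1, (size a').+1 = size a,
    uniq (values a') & 0 \notin values a' /\ zero_sum_free (p' ++ a')].
Proof.
case/mapP=> x xa x0 pC zf ua; exists (x :: p), (rem x a).
have pa := perm_to_rem xa.
have pv : perm_eq (values a) (x *+ n :: values (rem x a)).
  exact: (perm_map (fun x => x *+ n) pa).
split=> //=.
- by rewrite pC andbT /odd_torsion -x0.
- by rewrite (perm_size pa).
- by move: ua; rewrite (perm_uniq pv) => /andP[].
split; first by move: ua; rewrite (perm_uniq pv) -x0 => /andP[].
apply: perm_zero_sum_free zf; rewrite perm_sym -cat1s perm_catCA perm_cat2l.
by rewrite perm_sym.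
Qed.

Lemma take_distinct p a k : uniq (values a) -> 0 \notin values a ->
    zero_sum_free (p ++ a) -> (k <= size a)%N ->
  [/\ uniq (values (take k a)), 0 \notin values (take k a),
      zero_sum_free (p ++ take k a) & size (take k a) = k].
Proof.
move=> ua a0 zf le_k; rewrite /values map_take; split.
- exact: take_uniq.
- by apply: contra a0; apply: mem_take.
- by move: zf; rewrite -{1}(cat_take_drop k a) catA; apply: zero_sum_free_catl.
- by rewrite size_takel.
Qed.

Lemma missing_2tors a x : x \in missing a -> x *+ 2 == 0.
Proof. by rewrite missingP => /and3P[]. Qed.

Lemma missing_neq0 a x : x \in missing a -> x != 0.
Proof. by rewrite missingP => /and3P[]. Qed.

Lemma missing_labelled p a tv vals b : zero_sum_free (p ++ a) ->
    uniq (values a) -> 0 \notin values a -> independent b -> size b = 4 ->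
    perm_eq (missing a) (map (comb b) (map bits tv)) ->
    [seq l <- map bits (iota 0 16) | l \notin map bits (0%N :: tv)] = map bits vals ->
  exists2 a', labelled n b (map bits vals) a' & zero_sum_free (p ++ a').
Proof.
move=> zf ua a0 ib sz_b pm Ev.
have [a' pa lab] := complement_labelled ua a0 ib sz_b pm Ev.
by exists a' => //; apply: perm_zero_sum_free zf; rewrite perm_cat2l.
Qed.

Lemma missing4 a x y z w : perm_eq (missing a) [:: x; y; z; w] ->
  [/\ [/\ x *+ 2 == 0, y *+ 2 == 0, z *+ 2 == 0 & w *+ 2 == 0],
      [/\ x != 0, y != 0, z != 0 & w != 0],
      [/\ x != y, x != z & x != w] & [/\ y != z, y != w & z != w]].
Proof.
move=> pm; have um : uniq [:: x; y; z; w] by rewrite -(perm_uniq pm) uniq_missing.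
have mem t : t \in [:: x; y; z; w] -> t \in missing a by rewrite (perm_mem pm).
split.
- by split; apply/missing_2tors/mem; rewrite !inE eqxx ?orbT.
- by split; apply/missing_neq0/mem; rewrite !inE eqxx ?orbT.
- by move: um; rewrite /= !inE !negb_or => /andP[/and3P[]].
- by move: um; rewrite /= !inE !negb_or => /and4P[_ /andP[]].
Qed.

(** Coordinates in which the missing values are 1, 2, 3 and 4. *)
Lemma eleven_collinear p a x y z :
    all inC p -> (size p + 4)%N = n -> uniq (values a) -> 0 \notin values a ->
    perm_eq (missing a) [:: x; y; x + y; z] ->
  ~ zero_sum_free (p ++ a).
Proof.
move=> pC sz_p ua a0 pm zf.
have [[x2 y2 _ z2] [x0 y0 _ z0] [xy _ xz] [_ yz xyz]] := missing4 pm.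
have i3 : independent [:: z; x; y].
  apply: independent_three => //; first exact: independent_two.
  by rewrite z0 !(eq_sym z) xz yz xyz.
have [b' [sz_b' ib sz4]] := independent_complete cardV (k := 1) i3 erefl.
case: b' sz_b' ib sz4 => // w [] // _ ib sz4.
have [|//|a' lab zf'] := missing_labelled (tv := [:: 2; 1; 3; 4]%N) zf ua a0 ib sz4 _
    (vals := iota 5 11).
  by rewrite /bits /= !comb_cons !comb_nil !(mulr0n, mulr1n, addr0, add0r).
exact: no_eleven_coset lab pC sz_p zf'.
Qed.

(** Four distinct nonzero values are linearly independent, or three of them have
    sum zero, or all four do. *)
Lemma eleven_nonzero p a :
    all inC p -> (size p + 4)%N = n -> size a = 11 -> uniq (values a) -> 0 \notin values a ->
  ~ zero_sum_free (p ++ a).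
Proof.
move=> pC sz_p sz_a ua a0 zf.
have sz_m : size (missing a) = 4.
  by have := size_missing ua a0; rewrite sz_a => /(@addnI 11 _ 4).
have [t1 [t2 [t3 [t4 Em]]]] : exists t1 t2 t3 t4, missing a = [:: t1; t2; t3; t4].
  by case: (missing a) sz_m => [|t1 [|t2 [|t3 [|t4 [|? ?]]]]] // _; exists t1, t2, t3, t4.
have collinear x y z w : perm_eq [:: t1; t2; t3; t4] [:: x; y; w; z] -> w = x + y -> False.
  by move=> pt Ew; apply: (eleven_collinear (x := x) (y := y) (z := z)) zf => //;
     rewrite Em -Ew.
have perm4 (s : seq nat) : perm_eq (iota 0 4) s ->
    perm_eq [:: t1; t2; t3; t4] [seq nth 0 [:: t1; t2; t3; t4] i | i <- s].
  exact: perm_map.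
have pm : perm_eq (missing a) [:: t1; t2; t3; t4] by rewrite Em.
have [[t12 t22 t32 t42] [t10 t20 t30 t40] [n12 n13 n14] [n23 n24 n34]] := missing4 pm.
have i3 : independent [:: t3; t2; t1].
  apply: independent_three => //; first by apply: independent_two; rewrite // eq_sym.
  rewrite t30 (eq_sym t3) n23 (eq_sym t3) n13 /=; apply/eqP => E.
  apply: (collinear t2 t1 t4 t3 (perm4 [:: 1; 0; 2; 3]%N isT) E).
have [/spanP[l sz_l El]|t4_out] := boolP (t4 \in span [:: t3; t2; t1]); last first.
  have i4 := independent_cons i3 t42 t4_out.
  have [|//|a' lab zf'] := missing_labelled (tv := [:: 1; 2; 4; 8]%N) zf ua a0 i4 erefl _
    (vals := [:: 3; 5; 6; 7; 9; 10; 11; 12; 13; 14; 15]%N).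
    by rewrite Em /bits /= !comb_cons !comb_nil !(mulr0n, mulr1n, addr0, add0r).
  exact: no_eleven_independent lab pC sz_p zf'.
case: l sz_l El => [|c3 [|c2 [|c1 [|? ?]]]] //= _.
rewrite !comb_cons comb_nil addr0 => El.
case: c3 c2 c1 El => -[] [] /=; rewrite !(mulr0n, mulr1n, addr0, add0r) => El.
- have [b' [sz_b' ib sz4]] := independent_complete cardV (k := 1) i3 erefl.
  case: b' sz_b' ib sz4 => // w [] // _ ib sz4.
  have [|//|a' lab zf'] := missing_labelled (tv := [:: 1; 2; 4; 7]%N) zf ua a0 ib sz4 _
    (vals := [:: 3; 5; 6; 8; 9; 10; 11; 12; 13; 14; 15]%N).
    rewrite Em /bits /= !comb_cons !comb_nil !(mulr0n, mulr1n, addr0, add0r).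
    by rewrite El.
  exact: no_eleven_planar lab pC sz_p zf'.
- apply: (collinear t3 t2 t1 t4 (perm4 [:: 2; 1; 3; 0]%N isT) El).
- apply: (collinear t3 t1 t2 t4 (perm4 [:: 2; 0; 3; 1]%N isT) El).
- by rewrite El eqxx in n34.
- apply: (collinear t2 t1 t3 t4 (perm4 [:: 1; 0; 3; 2]%N isT) El).
- by rewrite El eqxx in n24.
- by rewrite El eqxx in n14.
- by rewrite El eqxx in t40.
Qed.

(** If the value 0 occurs, then its term joins [p] and nine of the other terms
    are already too many. *)
Theorem eleven_distinct p a :
    all inC p -> (size p + 4)%N = n -> size a = 11 -> uniq (values a) ->
  ~ zero_sum_free (p ++ a).
Proof.
move=> pC sz_p sz_a ua zf.
have [a0|a0] := boolP (0 \in values a); last exact: eleven_nonzero zf.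
have [p' [a' [p'C sz_p' sz_a' ua' [a'0 zf']]]] := zero_value_torsion a0 pC zf ua.
have [|ua'' _ zf'' sz_a''] := take_distinct (k := 9) ua' a'0 zf'.
  by move: sz_a'; rewrite sz_a => -[->].
by apply: (nine_distinct ctx p'C _ sz_a'' ua'') zf''; rewrite sz_p' -sz_p !addnS addn0.
Qed.

(** The two missing values and their sum form a plane with 0; twelve of the
    thirteen values lie off this plane. *)
Theorem thirteen_distinct p a :
    all inC p -> (size p + 5)%N = n -> size a = 13 -> uniq (values a) ->
  ~ zero_sum_free (p ++ a).
Proof.
move=> pC sz_p sz_a ua zf.
have [a0|a0] := boolP (0 \in values a).
  have [p' [a' [p'C sz_p' sz_a' ua' [a'0 zf']]]] := zero_value_torsion a0 pC zf ua.
  have [|ua'' _ zf'' sz_a''] := take_distinct (k := 11) ua' a'0 zf'.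
    by move: sz_a'; rewrite sz_a => -[->].
  by apply: (eleven_distinct p'C _ sz_a'' ua'') zf''; rewrite sz_p' addSnnS.
have sz_m : size (missing a) = 2.
  by have := size_missing ua a0; rewrite sz_a => /(@addnI 13 _ 2).
have [t1 [t2 Em]] : exists t1 t2, missing a = [:: t1; t2].
  by case: (missing a) sz_m => [|t1 [|t2 [|? ?]]] // _; exists t1, t2.
have i2 : independent [:: t2; t1].
  have t1m : t1 \in missing a by rewrite Em mem_head.
  have t2m : t2 \in missing a by rewrite Em !inE eqxx orbT.
  have := uniq_missing a; rewrite Em /= inE andbT eq_sym => n12.
  by apply: independent_two; rewrite ?(missing_2tors t1m) ?(missing_2tors t2m)
     ?(missing_neq0 t1m) ?(missing_neq0 t2m).
have [b' [sz_b' ib sz4]] := independent_complete cardV (k := 2) i2 erefl.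
case: b' sz_b' ib sz4 => // w [] // z [] // _ ib sz4.
have [|//|a' lab zf'] := missing_labelled (tv := [:: 1; 2]%N) zf ua a0 ib sz4 _
    (vals := iota 3 13).
  by rewrite Em /bits /= !comb_cons !comb_nil !(mulr0n, mulr1n, addr0, add0r).
case: lab => sz_b b2 szls; case: a' zf' => // y a' zf' [_ Ea'].
have lab' : labelled n [:: w, z & [:: t2; t1]] (map bits (iota 4 12)) a' by split.
apply: (no_twelve ctx lab' pC sz_p).
apply: (@zero_sum_free_catl _ _ [:: y]).
by apply: perm_zero_sum_free zf'; rewrite -catA perm_cat2l cats1 perm_sym perm_rcons.
Qed.

(** The values 1, 2 and 3 form a block, whose sum joins [p]; the other twelve lie
    off a plane. *)
Theorem fifteen_distinct p a :
    all inC p -> (size p + 6)%N = n -> size a = 15 -> uniq (values a) ->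
  ~ zero_sum_free (p ++ a).
Proof.
move=> pC sz_p sz_a ua zf.
have [a0|a0] := boolP (0 \in values a).
  have [p' [a' [p'C sz_p' sz_a' ua' [a'0 zf']]]] := zero_value_torsion a0 pC zf ua.
  have [|ua'' _ zf'' sz_a''] := take_distinct (k := 13) ua' a'0 zf'.
    by move: sz_a'; rewrite sz_a => -[->].
  by apply: (thirteen_distinct p'C _ sz_a'' ua'') zf''; rewrite sz_p' addSnnS.
have [b [sz_b ib _]] := independent_complete cardV (b := [::]) (k := 4) isT erefl.
rewrite cats0 in ib.
have sz_m : size (missing a) = 0.
  by have := size_missing ua a0; rewrite sz_a => /(@addnI 15 _ 0).
have [|//|a' lab zf'] := missing_labelled (tv := [::]) zf ua a0 ib sz_b _ (vals := iota 1 15).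
  by rewrite (size0nil sz_m).
have lineC : inC (\sum_(x <- take 3 a') x).
  have := packing_torsion (B := [:: 0; 1; 2]%N) lab isT.
  rewrite /block_sum; case: lab => _ _ _ /(congr1 size).
  rewrite size_map; case: (a') => [|x1 [|x2 [|x3 ?]]] //= _.
  by rewrite take0 !big_cons !big_nil.
case: lab => _ b2 szls Ea'.
have lab' : labelled n b (map bits (iota 4 12)) (drop 3 a').
  by split=> //; rewrite map_drop Ea'.
apply: (no_twelve ctx (p := (\sum_(x <- take 3 a') x) :: p) lab').
- by rewrite /= lineC.
- by rewrite /= addSnnS.
rewrite cat_cons; apply: zero_sum_free_merge.
  by rewrite -size_eq0 size_take -(size_map (fun x => x *+ n) a') Ea'.
apply: perm_zero_sum_free zf'.
by rewrite -{1}(cat_take_drop 3 a') perm_catCA.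
Qed.

End LargeValueSets.

(** * Seven distinct values and a pair of equal value *)

Definition two_disjoint (C : seq bitseq) : bool :=
  some (fun c1 => some (fun c2 => ~~ meetsw c1 c2) C) C.

(** The seven labels are an affine hyperplane without a point, which must be
    their sum q. Up to the choice of one direction h1 of the hyperplane, the value
    x of the pair is 0, q, a direction, or one of the seven labels. *)
Definition punctured_cube (ls : seq bitseq) (x : bitseq) : bool :=
  let q := foldr addw zerol ls in
  let H := map (addw q) ls in
  some (fun h1 => if x \in [:: zerol; q; h1; addw q h1] then
    some (fun h2 => some (fun h3 =>
      if all (mem ls) (behead (cube q h1 h2 h3)) then uniq (behead (cube q h1 h2 h3))
      else false) H) H else false) [:: x, addw q x & H].

Definition check7 (rest : seq bitseq) : bool :=
  let C := relations rest in
  if two_disjoint C then true else if dependent_triple C then true else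
  all (punctured_cube (rest ++ unitl)) (words 4).

Lemma check7P :
  all (fun m => if count id m == 3 then check7 (mask m nonunitl) else true) (words 12).
Proof. by vm_compute. Qed.

Section Seven.
Variables (n : nat) (G : finZmodType).
Hypothesis ctx : elementary_by_odd n G.
Implicit Types (p a b : seq G) (x y g : G) (B : seq nat) (P : seq (seq nat)).
Local Notation inC := (@odd_torsion n G).
Let n_gt2 := ebo_gt2 ctx.
Let cardC := ebo_cardC ctx.
Let cardV := ebo_cardV ctx.

(** Positions 2 to 8 carry the values 9 to 15; these are the planes among them. *)
Definition planes7 : seq (seq nat) :=
  [:: [:: 5; 6; 7; 8]; [:: 3; 4; 5; 6]; [:: 2; 4; 5; 7]; [:: 2; 3; 5; 8];
      [:: 3; 4; 7; 8]; [:: 2; 4; 6; 8]; [:: 2; 3; 6; 7]]%N.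

(** The pair and any one of the seven planes form a full packing, so that they
    have a common sum g; counting the planes through a point then gives 4 z = g
    for the points z. Each possible value of the pair contradicts this in its own
    way. *)
Lemma no_punctured_cube p a b v :
    v \in [:: 0; 4; 8; 12]%N ->
    labelled n b (map bits [:: v, v & iota 9 7]) a -> all inC p -> (size p).+3 = n ->
  ~ zero_sum_free (p ++ a).
Proof.
move=> v4 lab pC sz_p zf; set ls := map bits _ in lab.
have full P B : packing ls P -> size P = 2 -> B \in P ->
    [/\ saturating n (block_sum a B), p = nseq (size p) (block_sum a B)
      & {in P, forall B', block_sum a B' = block_sum a B}].
  by move=> PP szP BP; apply: (full_packing ctx lab zf pC PP _ BP); rewrite szP addn2.
pose F := block_sum a; pose g := F [:: 0; 1]%N.
have FE B : F B = block_sum a B by [].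
have planeP : all (fun D => packing ls [:: [:: 0; 1]%N; D]) planes7.
  by move: v4; rewrite /ls !inE => /or4P[] /eqP->.
have [sat pg _] := full [:: [:: 0; 1]; [:: 5; 6; 7; 8]]%N [:: 0; 1]%N
  (seq.allP planeP [:: 5; 6; 7; 8]%N isT) erefl isT.
have plane_g D : D \in planes7 -> F D = g.
  move=> DP; have [_ _ E] := full [:: [:: 0; 1]%N; D] [:: 0; 1]%N
    (seq.allP planeP _ DP) erefl (mem_head _ _).
  by apply: E; rewrite !inE eqxx orbT.
pose z i := F [:: i].
have FzE B : F B = \sum_(i <- B) z i.
  by rewrite /F /block_sum; apply: eq_bigr => i _; rewrite /z /F /block_sum big_seq1.
have gE : z 0%N + z 1%N = g by rewrite /g FzE !big_cons big_nil addr0.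
have g_absurd t k : g *+ (t + k) = g *+ t -> (0 < k < 3)%N -> False.
  move=> E /andP[k0 k3]; apply: (saturating_absurd ctx sat E).
  by rewrite k0; apply: leq_ltn_trans n_gt2.
(* Each point lies on four of the seven planes, any other point on two of these
   four and on two of the remaining three. *)
have quarter i : perm_eq (flatten [seq D <- planes7 | i \in D])
      (nseq 4 i ++ flatten [seq D <- planes7 | i \notin D]) ->
    size [seq D <- planes7 | i \in D] = 4 -> size [seq D <- planes7 | i \notin D] = 3 ->
    z i *+ 4 = g.
  move=> pD s4 s3; have sum_planes Ds : {subset Ds <= planes7} ->
      \sum_(j <- flatten Ds) z j = g *+ size Ds.
    move=> sD; rewrite big_flatten big_seq (eq_bigr (fun _ => g)).
      by rewrite -big_seq big_const_seq count_predT iter_addr_0.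
    by move=> D /sD/plane_g <-; rewrite FzE.
  have sub c : {subset [seq D <- planes7 | c D] <= planes7}.
    by apply: mem_subseq; apply: filter_subseq.
  have := sum_planes _ (sub (fun D : seq nat => i \in D)).
  have := sum_planes _ (sub (fun D : seq nat => i \notin D)).
  rewrite (perm_big _ pD) big_cat big_nseq iter_addr_0 s4 s3 => -> /= E.
  by apply: (addIr (g *+ 3)); rewrite E -mulrS.
have q2 : z 2%N *+ 4 = g by apply: quarter.
have q3 : z 3%N *+ 4 = g by apply: quarter.
have q4 : z 4%N *+ 4 = g by apply: quarter.
have q5 : z 5%N *+ 4 = g by apply: quarter.
have q6 : z 6%N *+ 4 = g by apply: quarter.
move: v4; rewrite !inE => /or4P[] /eqP Ev; subst v.
- (* the two extra terms are blocks by themselves *)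
  have := blocks_size cardC zf pC
    (packing_blocks (P := [:: [:: 0]; [:: 1]; [:: 5; 6; 7; 8]]%N) lab isT).
  by rewrite -sz_p addn3 ltnn.
- (* the value 4 is a direction of the hyperplane *)
  have y4 : z 0%N *+ 4 = g *+ 2.
    have [_ _ E] := full [:: [:: 0; 2; 6]; [:: 3; 4; 7; 8]]%N _ isT erefl (mem_last _ [:: _]).
    have : F [:: 0; 2; 6]%N = g.
      by rewrite -(plane_g [:: 3; 4; 7; 8]%N isT); apply: E; apply: mem_head.
    rewrite FzE !big_cons big_nil addr0 => /(congr1 (fun u => u *+ 4)).
    rewrite !mulrnDl q2 q6 -mulr2n => E4; apply: (addIr (g *+ 2)).
    by rewrite E4 -mulrnDr.
  have [t t12 Et] : exists2 t, (0 < t <= 2)%N & F [:: 0; 2; 3; 4; 5]%N = g *+ t.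
    apply: (packing_range ctx lab _ sat n_gt2) => //.
    by rewrite (_ : n.-1 - 2 = size p)%N -?pg //; rewrite -sz_p /= subn2.
  have : F [:: 0; 2; 3; 4; 5]%N *+ 4 = g *+ 6.
    rewrite FzE !big_cons big_nil addr0 !mulrnDl y4 q2 q3 q4 q5.
    by rewrite -mulr2n -!mulrS -mulrnDr.
  rewrite Et -mulrnA; case: t t12 {Et} => [|[|[|t]]] // _ E.
    by apply: (g_absurd 4 2)%N.
  by apply: (g_absurd 6 2)%N.
- (* the value 8 is the missing point of the hyperplane *)
  have y4 i : i \in [:: 0; 1]%N -> z i *+ 4 = g.
    move=> i01; have P2 : packing ls [:: [:: i; 2; 3; 4]; [:: 5; 6; 7; 8]]%N.
      by move: i01; rewrite !inE => /orP[] /eqP->.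
    have [_ _ E] := full _ _ P2 erefl (mem_last _ [:: _]).
    have : F [:: i; 2; 3; 4]%N = g.
      by rewrite -(plane_g [:: 5; 6; 7; 8]%N isT); apply: E; apply: mem_head.
    rewrite FzE !big_cons big_nil addr0 => /(congr1 (fun u => u *+ 4)).
    rewrite !mulrnDl q2 q3 q4 -mulr2n -mulrS => E4; apply: (addIr (g *+ 3)).
    by rewrite E4 -mulrS.
  apply: (g_absurd 2 2)%N => //.
  by rewrite -[in LHS]gE mulrnDl !y4 // -mulr2n.
(* the value 12 occurs among the seven points *)
have y4 i j : [|| (i == 0) && (j == 1) | (i == 1) && (j == 0)]%N ->
    z i + z j = g -> z i *+ 4 = g.
  move=> ij Eij; have P2 : packing ls [:: [:: i; 6; 7; 8]; [:: j; 5]]%N.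
    by case/orP: ij => /andP[/eqP-> /eqP->].
  have [_ _ E] := full _ _ P2 erefl (mem_last _ [:: _]).
  have {}E : F [:: i; 6; 7; 8]%N = F [:: j; 5]%N by apply: E; apply: mem_head.
  have D : F [:: 5; 6; 7; 8]%N = g by apply: plane_g.
  move: E D; rewrite !FzE !big_cons big_nil !addr0.
  set r := z 6%N + _ => E D.
  suff : z i *+ 2 = z 5%N *+ 2.
    by move/(congr1 (fun u => u *+ 2)); rewrite -!mulrnA q5.
  apply: (addIr g); rewrite -{1}D mulr2n addrACA E addrACA -mulr2n.
  by rewrite Eij addrC.
apply: (g_absurd 2 2)%N => //.
by rewrite -[in LHS]gE mulrnDl (y4 0%N 1%N isT gE) (y4 1%N 0%N isT (etrans (addrC _ _) gE)).
Qed.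

(** Seven of the eight elements of a subgroup: two disjoint blocks exist whichever
    element is absent, and they are too many. *)
Lemma seven_low_rank p a b : all inC p -> (size p).+2 = n -> size a = 7 ->
    uniq (values n a) -> independent b -> size b = 3 -> {subset values n a <= span b} ->
  ~ zero_sum_free (p ++ a).
Proof.
move=> pC sz_p sz_a ua ib sz_b sub zf.
have [b' [sz_b' ib4 sz4]] := independent_complete cardV (k := 1) ib ltac:(by rewrite sz_b).
case: b' sz_b' ib4 sz4 => // w [] // _ ib4 sz4.
have Espan : span b = map (comb (w :: b)) (map bits (iota 0 8)).
  have Eb : map bits (iota 0 8) = map (cons false) (words 3) by [].
  rewrite Eb -map_comp /span sz_b; apply: eq_map => l.
  by rewrite /= comb_cons mulr0n add0r.
have us : uniq (span b) by case/andP: ib.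
have [m m8 mA] : exists2 m, m \in iota 0 8 & comb (w :: b) (bits m) \notin values n a.
  apply/hasP/negPn; rewrite -all_predC; apply/negP => /allP all_in.
  have : (size (span b) <= size (values n a))%N.
    apply: uniq_leq_size us _ => x; rewrite Espan -map_comp => /mapP[v v8 ->].
    by apply: contraR (all_in v v8).
  by rewrite Espan !size_map sz_a.
have pA : perm_eq (values n a) (map (comb (w :: b)) (map bits (rem m (iota 0 8)))).
  have uL : uniq (map (comb (w :: b)) (map bits (rem m (iota 0 8)))).
    apply: subseq_uniq us; rewrite Espan; do 2!apply: map_subseq.
    exact: rem_subseq.
  have subL : {subset values n a <= map (comb (w :: b)) (map bits (rem m (iota 0 8)))}.
    move=> x xA; have := sub x xA; rewrite Espan -!map_comp => /mapP[v v8 xE].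
    apply/mapP; exists v => //; rewrite (mem_rem_uniq _ (iota_uniq 0 8)) inE v8 andbT.
    by apply: contraNneq mA => <-; move: xA; rewrite xE.
  have [|_ E] := uniq_min_size ua subL; first by rewrite !size_map size_rem // sz_a.
  exact: uniq_perm.
have [a' pa Ea'] := arrange_perm ua pA.
have lab : labelled n (w :: b) (map bits (rem m (iota 0 8))) a'.
  split=> //; first by case/andP: ib4.
  by apply/allP => l /mapP[v _ ->].
have {}zf : zero_sum_free (p ++ a').
  by apply: perm_zero_sum_free zf; rewrite perm_cat2l.
have no P : packing (map bits (rem m (iota 0 8))) P -> size P = 2 -> False.
  move=> PP szP; have := blocks_size cardC zf pC (packing_blocks lab PP).
  by rewrite szP -sz_p addn2 ltnn.
move: m8 no; rewrite !inE; do 7?[case/predU1P=> [->|]]; last move=> /eqP->; move=> no.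
- by apply: (no [:: [:: 0; 1; 2]; [:: 3; 4; 5; 6]]%N).
- by apply: (no [:: [:: 0]; [:: 1; 3; 5]]%N).
- by apply: (no [:: [:: 0]; [:: 1; 3; 4]]%N).
- by apply: (no [:: [:: 0]; [:: 2; 3; 5]]%N).
- by apply: (no [:: [:: 0]; [:: 1; 2; 3]]%N).
- by apply: (no [:: [:: 0]; [:: 1; 2; 3]]%N).
- by apply: (no [:: [:: 0]; [:: 1; 2; 3]]%N).
- by apply: (no [:: [:: 0]; [:: 1; 2; 3]]%N).
Qed.

(** The sum of the pair lies in [odd_torsion]. Next to it, two disjoint blocks are
    too many and every single block has the same sum y + y', which excludes
    dependent triples. In the shape that remains the pair is kept apart, as its
    terms may belong to different blocks. *)
Theorem seven_distinct p y y' a :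
    all inC p -> (size p).+3 = n -> y *+ n = y' *+ n -> size a = 7 ->
    uniq (values n a) ->
  ~ zero_sum_free (p ++ [:: y, y' & a]).
Proof.
move=> pC sz_p Ey sz_a ua zf; set A := values n a in ua.
have AV : all (fun x => x *+ 2 == 0) A := all_V ctx a.
have gC : inC (y + y') by rewrite /odd_torsion mulrnDl Ey -mulr2n (ebo_exp ctx).
have zfq : zero_sum_free ((y + y' :: p) ++ a).
  rewrite (_ : y + y' = \sum_(x <- [:: y; y']) x); last by rewrite !big_cons big_nil addr0.
  apply: (zero_sum_free_merge (R := p ++ a)) => //.
  by apply: perm_zero_sum_free zf; apply/permPl; apply: (perm_catCA p [:: y; y'] a).
have qC : all inC (y + y' :: p) by rewrite /= gC.
have [|b3 sz_b3 [ib3 b3A]] := @independent_in G A 3 AV ua; first by rewrite size_map sz_a.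
have [sub3|/allPn[w wA wb]] := boolP (all (mem (span b3)) A).
  by apply: (seven_low_rank qC _ sz_a ua ib3 sz_b3 (allP sub3) zfq).
have ib := independent_cons ib3 (seq.allP AV w wA) wb.
have bA : {subset w :: b3 <= A} by move=> x /predU1P[-> | /b3A].
have {sz_b3} sz_b : size (w :: b3) = 4 by rewrite /= sz_b3.
move: (w :: b3) ib bA sz_b => b ib bA sz_b {w wA wb b3 ib3 b3A}.
have b2 : all (fun x => x *+ 2 == 0) b by case/andP: ib.
pose m := [seq comb b l \in A | l <- nonunitl].
pose rest := mask m nonunitl.
have pA : perm_eq A (map (comb b) (rest ++ unitl)).
  apply: perm_trans (perm_labels ctx ib sz_b AV ua perm_words4) _.
  rewrite filter_cat filter_mask [X in _ ++ X](_ : _ = unitl) //.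
  apply/all_filterP/allP => l lU; apply: bA.
  by have := map_f (comb b) lU; rewrite comb_unitl.
have sz_rest : size rest = 3.
  have := perm_size pA; rewrite !size_map sz_a size_cat addnC.
  by move=> /(@addnI 4 3)/esym.
have [a' pa a'V] := arrange_perm ua pA.
have {}zfq : zero_sum_free ((y + y' :: p) ++ a').
  by apply: perm_zero_sum_free zfq; rewrite perm_cat2l.
have szU : all (fun l : bitseq => size l == 4) (rest ++ unitl).
  rewrite all_cat andbT; apply/allP => l /mem_mask.
  by move: l; apply/allP.
have lab : labelled n b (rest ++ unitl) a' by split.
have Cgood := labelled_relations lab.
have : check7 rest.
  have /allP/(_ m) := check7P; rewrite mem_words size_map => /(_ isT).
  by rewrite -(@size_mask _ m nonunitl) ?size_map // -/rest sz_rest.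
rewrite /check7; case: ifP => [|_].
  rewrite /two_disjoint someE => /hasP[c1 c1C]; rewrite someE => /hasP[c2 c2C] dis.
  have bl : blocks n a' (map elems [:: c1; c2]).
    by apply: blocks_words; rewrite /= ?Cgood // disjwE dis.
  by have := blocks_size cardC zfq qC bl; rewrite -sz_p /= addn2 ltnn.
case: ifP => [dep _|_ /allP cubes].
  have /eqP[] : y + y' != 0.
    rewrite -(big_seq1 (@GRing.add _) (y + y') id).
    by apply: (zero_sum_free_sum_neq0 (R := p ++ a') zfq).
  apply: (dependent_triple_eq0 (a := a') _ dep) => c cC; have gc := Cgood c cC.
  have bl : blocks n a' (map elems [:: c]) by apply: blocks_words; rewrite /= ?gc.
  split; first by case/and3P: gc => /eqP.
  rewrite -(block_sum_elems gc); apply: (blocks_const cardC zfq qC bl) => //.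
  - by rewrite /= addn1.
  - by rewrite !(mem_cat, inE) eqxx ?orbT.
  - by rewrite !(mem_cat, inE) eqxx ?orbT.
have yV : y *+ n *+ 2 == 0 by rewrite (ebo_exp ctx).
have /spanP[x sz_x Ex] := independent_full cardV ib sz_b yV.
have := cubes x; rewrite mem_words sz_x sz_b => /(_ isT).
rewrite /punctured_cube someE => /hasP[h1 h1L]; set q := foldr addw zerol _.
case: ifP => // xh; rewrite someE => /hasP[h2 h2H]; rewrite someE => /hasP[h3 h3H].
case: ifP => // sub uc.
have sz4 l : l \in rest ++ unitl -> size l = 4 by move=> /(seq.allP szU)/eqP.
have sz_q : size q = 4.
  rewrite /q; elim: (rest ++ unitl) szU => //= l ls IH /andP[/eqP sl /IH E].
  by rewrite size_addw ?sl ?E.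
have szH l : l \in [seq addw q l | l <- rest ++ unitl] -> size l = 4.
  by case/mapP=> l' /sz4 sl' ->; rewrite size_addw ?sz_q.
have s2 := szH _ h2H; have s3 := szH _ h3H.
have s1 : size h1 = 4.
  case/predU1P: h1L => [->|/predU1P[->|/szH //]]; first by rewrite sz_x.
  by rewrite size_addw sz_q // sz_x.
have szc : all (fun l : bitseq => size l == 4) [:: h1; q; h2; h3].
  by rewrite /= s1 s2 s3 sz_q.
have E := comb_cube b2 sz_b szc.
pose bq := [:: comb b q; comb b h1; comb b h2; comb b h3].
have {}E : map (comb bq) (map bits (iota 9 7)) = map (comb b) (behead (cube q h1 h2 h3)).
  by move/(congr1 (drop 2)): E.
have [|||a'' [r [pa'' a''V]]] := arrange (n := n) (a := a')
  (L := map (comb b) (behead (cube q h1 h2 h3))).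
- by rewrite a'V -(perm_uniq pA).
- rewrite uniq_comb // sz_b; apply/allP => l /(seq.allP sub)/sz4->//.
- by move=> _ /mapP[l /(seq.allP sub) lL ->]; rewrite a'V map_f.
have [v v4 Ev] : exists2 v, v \in [:: 0; 4; 8; 12]%N & y *+ n = comb bq (bits v).
  rewrite Ex; move: xh; rewrite !inE => /or4P[] /eqP->.
  - by exists 0%N => //; rewrite (comb0 _ 4) (comb0 _ 4).
  - by exists 8%N => //; rewrite /bits /= !comb_cons comb_nil !(mulr0n, mulr1n, addr0, add0r).
  - by exists 4%N => //; rewrite /bits /= !comb_cons comb_nil !(mulr0n, mulr1n, addr0, add0r).
  exists 12%N => //; rewrite /bits /= !comb_cons comb_nil !(mulr0n, mulr1n, addr0, add0r).
  by rewrite comb_addw ?sz_b.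
apply: (no_punctured_cube (b := bq) (a := [:: y, y' & a'']) v4 _ pC sz_p).
  split=> //.
  - apply/allP => u ub; apply: (seq.allP (span_inV b2)); apply/spanP.
    move: ub; rewrite !inE => /or4P[] /eqP->;
      [exists q | exists h1 | exists h2 | exists h3]; rewrite ?sz_b //.
  by rewrite /= a''V -E -Ey Ev.
apply: (@zero_sum_free_catl _ _ r); apply: perm_zero_sum_free zf.
rewrite -catA perm_cat2l /= !perm_cons; apply: perm_trans pa _.
exact: pa''.
Qed.

End Seven.

(** * The upper bound *)

Lemma has_addw (u w : bitseq) : size u = size w -> u != w -> has id (addw u w).
Proof.
elim: u w => [|c u IH] [|d w] //= [sz]; rewrite eqseq_cons negb_and.
by rewrite /= -/(addw u w); case: c d => -[] //= /IH ->.
Qed.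

Section UpperBound.
Variables (n : nat) (G : finZmodType).
Hypothesis ctx : elementary_by_odd n G.
Implicit Types (p a b S R : seq G) (x y g : G) (ps : seq (G * G)).
Local Notation inC := (@odd_torsion n G).
Let cardC := ebo_cardC ctx.
Let cardV := ebo_cardV ctx.

Definition pair_terms ps : seq G := flatten [seq [:: d.1; d.2] | d <- ps].

Lemma pair_up S : exists ps a,
  [/\ perm_eq S (pair_terms ps ++ a), all (fun d => d.1 *+ n == d.2 *+ n) ps
    & uniq (values n a)].
Proof.
elim: S => [|x S [ps [a [pS eps ua]]]]; first by exists [::], [::].
have [xa|xa] := boolP (x *+ n \in values n a); last first.
  exists ps, (x :: a); split=> //=; last by rewrite xa.
  apply: perm_trans (_ : perm_eq _ (x :: pair_terms ps ++ a)) _; first by rewrite perm_cons.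
  by rewrite -cat1s perm_catCA.
case/mapP: xa => y ya Exy; exists ((x, y) :: ps), (rem y a); split.
- rewrite /= perm_cons; apply: perm_trans pS _.
  rewrite -[y :: _]cat1s perm_sym perm_catCA perm_cat2l perm_sym.
  exact: perm_to_rem.
- by rewrite /= Exy eqxx.
apply: subseq_uniq ua; apply: map_subseq; exact: rem_subseq.
Qed.

Lemma merge_pairs ps R : all (fun d => d.1 *+ n == d.2 *+ n) ps ->
    zero_sum_free (pair_terms ps ++ R) ->
  all inC [seq d.1 + d.2 | d <- ps] /\ zero_sum_free ([seq d.1 + d.2 | d <- ps] ++ R).
Proof.
elim: ps R => [|d ps IH] R //= /andP[/eqP Ed eps] zf.
have zf1 : zero_sum_free (d.1 + d.2 :: pair_terms ps ++ R).
  have := @zero_sum_free_merge _ [:: d.1; d.2] (pair_terms ps ++ R) isT zf.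
  by rewrite !big_cons big_nil addr0.
have [//||pC zf2] := IH (d.1 + d.2 :: R).
  apply: perm_zero_sum_free zf1; apply/permPl.
  exact: (perm_catCA [:: d.1 + d.2]).
split; first by rewrite pC andbT /odd_torsion mulrnDl Ed -mulr2n (ebo_exp ctx).
by apply: perm_zero_sum_free zf2; apply/permPl; apply: (perm_catCA _ [:: _]).
Qed.

(** Since 2 ^ 5 > 16, five values satisfy a relation, which gives a block. *)
Lemma five_distinct p a : all inC p -> (size p).+1 = n -> size a = 5 ->
  ~ zero_sum_free (p ++ a).
Proof.
move=> pC sz_p sz_a zf; set A := values n a.
have AV : all (fun x => x *+ 2 == 0) A := all_V ctx a.
have sz_A : size A = 5 by rewrite size_map.
have : ~~ uniq (span A).
  apply/negP => us; have : (size (span A) <= #|[set x : G | (x *+ 2 == 0)%R]|)%N.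
    rewrite cardE; apply: uniq_leq_size us _ => x /(seq.allP (span_inV AV)).
    by rewrite mem_enum inE.
  by rewrite cardV size_map size_words sz_A.
case/(uniqPn (0 : G)) => i [j []].
rewrite size_map size_words sz_A => lt_ij lt_j.
rewrite !(nth_map [::]) ?size_words ?sz_A //; last exact: ltn_trans lt_j.
set u := nth _ _ i; set w := nth _ _ j => Euw.
have [su sw] : size u = 5 /\ size w = 5.
  by split; apply/eqP; rewrite -mem_words mem_nth ?size_words //; apply: ltn_trans lt_j.
have neq : u != w.
  by rewrite nth_uniq ?uniq_words ?size_words ?neq_ltn ?lt_ij //; apply: ltn_trans lt_j.
have g : good_word n a (addw u w).
  have h0 := has_addw (etrans su (esym sw)) neq.
  rewrite /good_word size_addw su ?sw // sz_a eqxx h0 //=.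
  have : comb A (addw u w) = 0.
    rewrite comb_addw ?sz_A // Euw -mulr2n.
    by apply/eqP/(seq.allP (span_inV AV))/spanP; exists w; rewrite ?sz_A.
  by rewrite /comb /A /values -map_mask big_map sumrMnl => /eqP.
have bl : blocks n a (map elems [:: addw u w]) by apply: blocks_words; rewrite /= ?g.
by have := blocks_size cardC zf pC bl; rewrite -sz_p /= addn1 ltnn.
Qed.

(** Pairs of equal value are merged into elements of [odd_torsion] until the
    remaining values are distinct. Their number is odd, at most 15, and each
    possibility is excluded above. *)
Theorem zero_sum_free_bound S : zero_sum_free S -> (size S <= n.*2.+2)%N.
Proof.
move=> zfS; rewrite leqNgt; apply/negP => ltS.
have {ltS}[S' sz_S {}zfS] : exists2 S' : seq G, size S' = n.*2.+3 & zero_sum_free S'.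
  exists (take n.*2.+3 S); first by rewrite size_takel.
  by apply: (@zero_sum_free_catl _ _ (drop n.*2.+3 S)); rewrite cat_take_drop.
have [ps [a [pS eps ua]]] := pair_up S'.
have {}zfS := perm_zero_sum_free pS zfS.
have sz : ((size ps).*2 + size a)%N = n.*2.+3.
  rewrite -sz_S (perm_size pS) size_cat size_flatten /shape -map_comp; congr (_ + _)%N.
  by elim: (ps) => //= d ps' IH; rewrite doubleS IH.
have [a7|a7] := eqVneq (size a) 7%N.
  case: ps sz eps zfS {pS} => [|d ps] sz eps zf.
    by move: sz (ebo_gt2 ctx) => /=; lia.
  have [Ed eps'] := andP eps.
  have zf1 : zero_sum_free (pair_terms ps ++ [:: d.1, d.2 & a]).
    by apply: perm_zero_sum_free zf; apply/permPl; apply: (perm_catCA [:: d.1; d.2]).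
  have [pC' zf'] := merge_pairs eps' zf1.
  apply: (seven_distinct ctx pC' _ (eqP Ed) a7 ua zf').
  by rewrite size_map; move: sz => /=; lia.
have [pC zf] := merge_pairs eps zfS.
have le_a : (size a <= 16)%N.
  have <- : size (values n a) = size a by rewrite size_map.
  move: cardV; rewrite cardE => <-; apply: uniq_leq_size ua _ => x xa.
  by rewrite mem_enum inE; move: x xa; apply/allP/(all_V ctx).
move: pC zf; set p : seq G := [seq _ | _ <- _] => pC zf.
have sz_p : size p = size ps by rewrite size_map.
have lt_p : (size p < n)%N.
  by apply: (zero_sum_free_torsion_size cardC pC); apply: zero_sum_free_catl zf.
have sz2 : ((size p).*2 + size a)%N = n.*2.+3 by rewrite sz_p.
have [a5|a5] := eqVneq (size a) 5%N; first by apply: (five_distinct pC _ a5 zf); lia.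
have [a9|a9] := eqVneq (size a) 9%N.
  by apply: (nine_distinct ctx pC _ a9 ua zf); lia.
have [a11|a11] := eqVneq (size a) 11%N.
  by apply: (eleven_distinct ctx pC _ a11 ua zf); lia.
have [a13|a13] := eqVneq (size a) 13%N.
  by apply: (thirteen_distinct ctx pC _ a13 ua zf); lia.
have [a15|a15] := eqVneq (size a) 15%N.
  by apply: (fifteen_distinct ctx pC _ a15 ua zf); lia.
lia.
Qed.

End UpperBound.

(** * Coordinates *)

Lemma Zp_nat_eq m i j : (1 < m)%N -> ((i%:R : 'Z_m) == j%:R) = (i == j %[mod m])%N.
Proof. by move=> m1; rewrite -val_eqE /= !val_Zp_nat. Qed.

Lemma eqn_mod_gap m k t : (0 < t < m)%N -> (k + t == k %[mod m])%N = false.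
Proof.
case/andP=> t0 tm; rewrite -[in X in _ == X](addn0 k) eqn_modDl mod0n modn_small //.
by apply/negbTE; rewrite -lt0n.
Qed.

(** The coordinates of C_2 + C_2 + C_2 + C_2n are natural numbers, to be read
    modulo 2 and 2 n, so that addition involves no reduction. *)
Definition coordinates n (G : finZmodType) (F : nat -> nat -> nat -> nat -> G) : Prop :=
  [/\ forall i j l k i' j' l' k',
        F i j l k + F i' j' l' k' = F (i + i')%N (j + j')%N (l + l')%N (k + k')%N,
      forall i j l k i' j' l' k', (F i j l k == F i' j' l' k') =
        [&& i == i' %[mod 2], j == j' %[mod 2], l == l' %[mod 2] & k == k' %[mod 2 * n]]%N
    & forall x, exists i j l k, x = F i j l k].

Lemma isog_coordinates n (G : finZmodType) : (0 < n)%N ->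
    [set: G] \isog [set: 'Z_2 * 'Z_2 * 'Z_2 * 'Z_(2 * n)] ->
  exists F : nat -> nat -> nat -> nat -> G, coordinates n F.
Proof.
move=> n_gt0; rewrite isog_sym => /isogP[f injf imf].
have m1 : (1 < 2 * n)%N by lia.
pose F i j l k : G := f (i%:R, j%:R, l%:R, k%:R).
have injF : injective f by move=> x y; apply: (injmP injf); rewrite inE.
exists F; split=> [i j l k i' j' l' k' | i j l k i' j' l' k' | x].
- by rewrite /F -[LHS]morphM ?inE //; congr (f _); rewrite !natrD.
- by rewrite /F (inj_eq injF) -!pair_eqE /= /pair_eq /= -!pair_eqE /= /pair_eq /= -!pair_eqE /=
             /pair_eq /= !Zp_nat_eq // -!andbA.
have : x \in (f @* [set: 'Z_2 * 'Z_2 * 'Z_2 * 'Z_(2 * n)])%g by rewrite imf inE.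
case/morphimP=> -[[[i j] l] k] _ _ ->.
by exists i, j, l, k; rewrite /F !natr_Zp.
Qed.

Lemma subseq_cat_nseq (T : eqType) (s a : seq T) k x : subseq s (a ++ nseq k x) ->
  exists w j, [/\ size w = size a, (j <= k)%N & s = mask w a ++ nseq j x].
Proof.
case/subseqP=> w; rewrite size_cat size_nseq => sz_w ->.
exists (take (size a) w), (count id (drop (size a) w)).
have sz_t : size (take (size a) w) = size a by rewrite size_takel // sz_w leq_addr.
split=> //; first by rewrite (leq_trans (count_size _ _)) // size_drop sz_w addKn.
rewrite -{1}(cat_take_drop (size a) w) mask_cat //; congr (_ ++ _).
have : size (drop (size a) w) = k by rewrite size_drop sz_w addKn.
by elim: (drop _ _) k {sz_w} => [|[] u IH] [|k] //= [/IH->].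
Qed.

Section Coordinates.
Variables (n : nat) (G : finZmodType) (F : nat -> nat -> nat -> nat -> G).
Hypotheses (n_gt2 : (2 < n)%N) (odd_n : odd n) (co : coordinates n F).
Implicit Types (T : seq G) (H : {group G}).
Let FD := let: And3 h _ _ := co in h.
Let FE := let: And3 _ h _ := co in h.
Let Fsurj := let: And3 _ _ h := co in h.

Lemma coord0 : F 0 0 0 0 = 0.
Proof. by apply: (addrI (F 0 0 0 0)%N); rewrite addr0 FD. Qed.

Lemma coord_eq0 i j l k :
  (F i j l k == 0) = [&& 2 %| i, 2 %| j, 2 %| l & 2 * n %| k]%N.
Proof. by rewrite -coord0 FE !mod0n. Qed.

Lemma coordMn i j l k t : F i j l k *+ t = F (i * t)%N (j * t)%N (l * t)%N (k * t)%N.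
Proof.
elim: t => [|t IH]; first by rewrite mulr0n !muln0 coord0.
by rewrite mulrS IH FD !mulnS.
Qed.

Lemma card_coordinates : #|G| = (16 * n)%N.
Proof.
pose f (t : 'I_2 * 'I_2 * 'I_2 * 'I_(2 * n)) := F t.1.1.1 t.1.1.2 t.1.2 t.2.
have injf : injective f.
  move=> [[[i j] l] k] [[[i' j'] l'] k'] /eqP; rewrite FE /= !modn_small ?ltn_ord //.
  by case/and4P=> /eqP/val_inj-> /eqP/val_inj-> /eqP/val_inj-> /eqP/val_inj->.
have -> : #|G| = #|[set f t | t : 'I_2 * 'I_2 * 'I_2 * 'I_(2 * n)]|.
  rewrite -cardsT; apply: eq_card => x; rewrite !inE; apply/esym/imsetP.
  have [i [j [l [k ->]]]] := Fsurj x.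
  have m_gt0 : (0 < 2 * n)%N by lia.
  exists (Ordinal (ltn_pmod i (isT : 0 < 2)%N), Ordinal (ltn_pmod j (isT : 0 < 2)%N),
          Ordinal (ltn_pmod l (isT : 0 < 2)%N), Ordinal (ltn_pmod k m_gt0)) => //.
  by apply/eqP; rewrite FE /= !modn_mod !eqxx.
by rewrite card_imset // !card_prod !card_ord; lia.
Qed.

Lemma coordinates_elementary : elementary_by_odd n G.
Proof.
split=> // [||x].
- pose f (k : 'I_n) := F 0 0 0 k.*2.
  have -> : [set x : G | x *+ n == 0] = [set f k | k : 'I_n].
    apply/setP => x; rewrite inE; apply/eqP/imsetP => [| [k _ ->]].
      have [i [j [l [k ->]]]] := Fsurj x; rewrite coordMn => /eqP.
      have c2 : coprime 2 n by rewrite coprime2n.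
      rewrite coord_eq0 !(Gauss_dvdl _ c2) dvdn_pmul2r; last by lia.
      case/and4P=> i2 j2 l2 k2; have n_gt0 : (0 < n)%N by lia.
      exists (Ordinal (ltn_pmod k./2 n_gt0)) => //; apply/eqP.
      rewrite FE !mod0n /= -!/(dvdn _ _) i2 j2 l2 /=; apply/eqP.
      by rewrite -mul2n muln_modr modn_mod mul2n; congr (_ %% _)%N; lia.
    by apply/eqP; rewrite coordMn coord_eq0 !mul0n !dvdn0 -muln2 -mulnA dvdn_mull.
  rewrite card_imset ?card_ord // => k k' /eqP.
  rewrite FE !eqxx /= => /eqP.
  have lt2 (m : 'I_n) : (m.*2 < 2 * n)%N by rewrite mul2n ltn_double.
  by rewrite (modn_small (lt2 k)) (modn_small (lt2 k')) => /double_inj/val_inj.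
- pose f (t : bool * bool * bool * bool) := F t.1.1.1 t.1.1.2 t.1.2 (t.2 * n)%N.
  have -> : [set x : G | x *+ 2 == 0] = [set f t | t : bool * bool * bool * bool].
    apply/setP => x; rewrite inE; apply/eqP/imsetP => [| [t _ ->]].
      have [i [j [l [k ->]]]] := Fsurj x; rewrite coordMn => /eqP.
      rewrite coord_eq0 (mulnC k) dvdn_pmul2l // => /and4P[_ _ _ /dvdnP[u ->]].
      exists (odd i, odd j, odd l, odd u) => //; apply/eqP.
      by rewrite FE /= !modn2 !oddb !eqxx /= -!muln_modl !modn2 oddb.
    by apply/eqP; rewrite coordMn coord_eq0 !(dvdn_mull _ (dvdnn 2)) /= -mulnA (mulnC n) dvdn_mull.
  rewrite card_imset ?card_prod ?card_bool // => -[[[i j] l] k] [[[i' j'] l'] k'] /eqP.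
  rewrite FE /= !modn2 !oddb -!muln_modl !eqn_pmul2r ?modn2 ?oddb; last by lia.
  by case/and4P=> /eqP/(can_inj oddb)-> /eqP/(can_inj oddb)-> /eqP/(can_inj oddb)-> /eqP/(can_inj oddb)->.
have [i [j [l [k ->]]]] := Fsurj x; rewrite -mulrnA coordMn; apply/eqP.
by rewrite coord_eq0 (mulnC n) !(dvdn_mull _ (dvdn_mulr n (dvdnn 2))) dvdn_mull.
Qed.

End Coordinates.

(** * Extremal sequences *)

Section Extension.
Variable G : finZmodType.
Implicit Types (S : seq G) (x : G).

Lemma zero_sum_free_cons S x : zero_sum_free S -> x != 0 -> x \notin Sigma S ->
  zero_sum_free (- x :: S).
Proof.
move=> /zero_sum_freeP zf x0 xS; apply/zero_sum_freeP => T; case: T => // y T.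
rewrite /=; case: ifP => [/eqP-> sT _ | _ sT _]; last exact: zf.
rewrite big_cons addrC subr_eq0; have [->|T0] := eqVneq T [::].
  by rewrite big_nil eq_sym.
by apply: contra xS => /eqP <-; apply/SigmaP; exists T.
Qed.

Lemma davenportP d : (exists2 S : seq G, zero_sum_free S & size S = d) ->
  (forall S : seq G, zero_sum_free S -> (size S <= d)%N) -> davenport G = d.
Proof.
case=> S zfS szS ub; rewrite /davenport; case: ex_maxnP => k /existsP[T zfT] maxk.
apply/eqP; rewrite eqn_leq -{1}(size_tuple T) ub //= maxk //.
by apply/existsP; rewrite -szS; exists (in_tuple S).
Qed.

(** The negative of a missing element could be appended. *)
Lemma long_missing0 d S : (forall S : seq G, zero_sum_free S -> (size S <= d)%N) ->
  zero_sum_free S -> (d <= size S)%N -> [set~ 0] :\: Sigma S = set0.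
Proof.
move=> ub zf szS; apply/setP => x; rewrite !inE; apply/negP => /andP[xS x0].
by have := ub _ (zero_sum_free_cons zf x0 xS); rewrite /= ltnNge szS.
Qed.

End Extension.

Lemma twisted_residues n c k : (2 < n)%N -> (c + c = n.+1)%N -> (k <= n.*2 - 3)%N ->
  [/\ (c + (c + k) == n %[mod 2 * n])%N = false,
      (c + (c + k) == n.-1 %[mod 2 * n])%N = false,
      (c + (c + (c + (c + k))) == 0 %[mod 2 * n])%N = false
    & (0 < k)%N -> (k == 0 %[mod 2 * n])%N = false].
Proof.
move=> n_gt2 Ec le_k; have lt_k : (k + 2 < 2 * n)%N by lia.
split.
- have -> : (c + (c + k) = n + (k + 1))%N by lia.
  by apply: eqn_mod_gap; lia.
- have -> : (c + (c + k) = n.-1 + (k + 2))%N by lia.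
  by apply: eqn_mod_gap; lia.
- have -> : (c + (c + (c + (c + k))) = 2 * n + (0 + (k + 2)))%N by lia.
  by rewrite modnDl eqn_mod_gap //; lia.
by move=> k0; rewrite -{1}[k]add0n eqn_mod_gap // k0; lia.
Qed.

Section LowerBounds.
Variables (n : nat) (G : finZmodType) (F : nat -> nat -> nat -> nat -> G).
Hypotheses (n_gt2 : (2 < n)%N) (odd_n : odd n) (co : coordinates n F).
Implicit Types (T : seq G) (H : {group G}).
Let FD := let: And3 h _ _ := co in h.
Let FE := let: And3 _ h _ := co in h.
Let Fsurj := let: And3 _ _ h := co in h.
Let ctx := coordinates_elementary n_gt2 odd_n co.

Lemma sum_axis k : \sum_(x <- nseq k (F 0 0 0 1)) x = F 0 0 0 k.
Proof. by rewrite big_nseq iter_addr_0 (coordMn co) !mul0n mul1n. Qed.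

Definition basis_seq : seq G :=
  [:: F 1 0 0 0; F 0 1 0 0; F 0 0 1 0] ++ nseq n.*2.-1 (F 0 0 0 1).

Lemma basis_seq_zero_sum_free : zero_sum_free basis_seq.
Proof.
apply/zero_sum_freeP => T /subseq_cat_nseq[w [k [sz_w le_k ->]]] T0.
case: w sz_w T0 => [|[] [|[] [|[] []]]] //= _ T0;
  rewrite ?big_cons sum_axis ?FD ?(coord_eq0 co) //=.
apply: contra T0 => /dvdn_leq; case: (k) le_k => // k'; lia.
Qed.

Lemma davenport_coordinates : davenport G = n.*2.+2.
Proof.
apply: davenportP; last exact: zero_sum_free_bound ctx.
exists basis_seq; first exact: basis_seq_zero_sum_free.
by rewrite size_cat size_nseq /=; lia.
Qed.

(** As 2 c = n + 1, two of the first four terms contribute n + 1 to the last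
    coordinate and all four contribute 2 modulo 2 n. The other terms add at most
    2 n - 3 to this, so that the last coordinates n - 1 and n are not reached with
    two of the four terms. *)
Definition twisted_seq : seq G := let c := n.+1./2 in
  [:: F 1 0 0 c; F 0 1 0 c; F 0 0 1 c; F 1 1 1 c] ++ nseq (n.*2 - 3) (F 0 0 0 1).

Definition twisted_missing : seq G :=
  [:: F 1 1 0 n; F 1 1 0 n.-1; F 1 0 1 n; F 0 1 1 n]%N.

Lemma twisted_sums T : subseq T twisted_seq -> T != [::] ->
  \sum_(x <- T) x \notin 0 :: twisted_missing.
Proof.
have Ec : (n.+1./2 + n.+1./2 = n.+1)%N by lia.
move=> /subseq_cat_nseq[w [k [sz_w le_k ->]]] T0.
move: (n.+1./2) Ec sz_w T0 => c Ec sz_w T0.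
have [c2n c2n1 c4 c0] := twisted_residues n_gt2 Ec le_k.
case: w sz_w T0 => [|[] [|[] [|[] [|[] []]]]] //= _ T0;
  rewrite ?big_cons sum_axis ?FD -(coord0 co) !inE !FE /= ?c2n ?c2n1 ?c4 ?c0 //.
by case: (k) T0.
Qed.

Lemma twisted_seq_zero_sum_free : zero_sum_free twisted_seq.
Proof.
apply/zero_sum_freeP => T sT T0.
by have := twisted_sums sT T0; rewrite inE negb_or => /andP[].
Qed.

Lemma twisted_missing_sub x : x \in twisted_missing -> x \in [set~ 0] :\: Sigma twisted_seq.
Proof.
move=> xM; rewrite !inE; apply/andP; split.
  apply/SigmaP => -[T [sT T0 Ex]].
  by have := twisted_sums sT T0; rewrite inE negb_or Ex xM andbF.
by move: xM; rewrite !inE => /or4P[] /eqP->; rewrite (coord_eq0 co).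
Qed.

Lemma coset_shift H a x d : x \in [set a + h | h in H] -> x + d \in [set a + h | h in H] ->
  d \in H.
Proof.
case/imsetP=> h hH -> /imsetP[h' h'H]; rewrite -addrA => /addrI E.
have -> : d = - h + h' by rewrite -E addKr.
by apply: groupM; rewrite ?groupV.
Qed.

(** If all missing elements lie in a + H, then their differences F 0 0 0 1 and
    F 1 1 0 0 are in H, hence so are the missing element F 1 1 0 n and a. *)
Lemma nu_ge : (n.*2.+2 <= nu G)%N.
Proof.
rewrite /nu; case: ex_minnP => l /asboolP miss _; rewrite leqNgt; apply/negP => lt_l.
have [|H [a [_ aH sub]]] := miss _ twisted_seq_zero_sum_free.
  by rewrite size_cat size_nseq /=; lia.
have inA x : x \in twisted_missing -> x \in [set a + h | h in H].
  by move/twisted_missing_sub; apply: (subsetP sub).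
have gH : F 0 0 0 1 \in H.
  apply: (coset_shift (inA (F 1 1 0 n.-1) _)); first by rewrite !inE eqxx orbT.
  by rewrite FD !addn0 addn1 prednK ?inA ?mem_head //; lia.
have eH : F 1 1 0 0 \in H.
  apply: (coset_shift (inA (F 1 0 1 n) _)); first by rewrite !inE eqxx !orbT.
  rewrite FD (_ : F _ _ _ _ = F 0 1 1 n); last by apply/eqP; rewrite FE (addn0 n) !eqxx.
  by rewrite inA // !inE eqxx !orbT.
have /imsetP[h hH E] := inA (F 1 1 0 n) (mem_head _ _).
case/negP: aH; have -> : a = F 1 1 0 0 + F 0 0 0 1 *+ n - h.
  by rewrite (coordMn co) FD !mul0n mul1n E addrK.
by rewrite groupM ?groupV // groupM // -FinRing.zmodXgE groupX.
Qed.

Lemma index_two_subgroup :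
  exists (H : {group G}) (a : G), #|[set: G] : H|%g = 2%N /\ a \notin H.
Proof.
pose f (t : 'I_2 * 'I_2 * 'I_(2 * n)) := F 0 t.1.1 t.1.2 t.2.
pose K := [set f t | t : 'I_2 * 'I_2 * 'I_(2 * n)].
have KE i j l k : (F i j l k \in K) = (2 %| i)%N.
  apply/imsetP/idP => [[t _ /eqP] | i2]; first by rewrite FE mod0n => /and4P[].
  have m_gt0 : (0 < 2 * n)%N by lia.
  exists (Ordinal (ltn_pmod j (isT : 0 < 2)%N), Ordinal (ltn_pmod l (isT : 0 < 2)%N),
          Ordinal (ltn_pmod k m_gt0)) => //.
  by apply/eqP; rewrite FE /= !modn_mod !eqxx mod0n !andbT.
have gK : group_set K.
  apply/group_setP; split=> [|x y].
    by rewrite -[1%g]/(0 : G) -(coord0 co) KE.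
  have [i [j [l [k ->]]]] := Fsurj x; have [i' [j' [l' [k' ->]]]] := Fsurj y.
  by rewrite !KE [(_ * _)%g]FD KE; apply: dvdn_add.
exists (Group gK), (F 1 0 0 0); split; last by rewrite KE.
have injf : injective f.
  move=> [[j l] k] [[j' l'] k'] /eqP; rewrite FE /= !modn_small ?ltn_ord //.
  by case/and3P=> /eqP/val_inj-> /eqP/val_inj-> /eqP/val_inj->.
have cK : #|K| = (8 * n)%N by rewrite card_imset // !card_prod !card_ord; lia.
have cG : #|[set: G]| = (2 * (8 * n))%N by rewrite cardsT (card_coordinates n_gt2 odd_n co); lia.
by rewrite -divgS ?subsetT // cG [X in (_ %/ X)%N]cK mulnK //; lia.
Qed.

(** From length 2 n + 2 on nothing is missing, and any subgroup of index 2 does. *)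
Lemma nu2_le : (nu_index G 2 <= n.*2.+2)%N.
Proof.
rewrite /nu_index; case: ex_minnP => l _; apply; apply/asboolP => T zfT sz_T.
have [H [a [iH aH]]] := index_two_subgroup; exists H, a; split; [exact/eqP | by [] | ].
by rewrite (long_missing0 (zero_sum_free_bound ctx) zfT sz_T) sub0set.
Qed.

Lemma nu_le_nu2 : (nu G <= nu_index G 2)%N.
Proof.
rewrite /nu_index; case: ex_minnP => l /asboolP miss _; rewrite /nu; case: ex_minnP => l' _; apply.
apply/asboolP => T zfT /(miss T zfT)[H [a [/eqP iH aH sub]]]; exists H, a; split=> //.
by apply/properP; split; [exact: subsetT | exists a; rewrite ?inE].
Qed.

End LowerBounds.

(** * Invariant factors *)

Lemma prod_abelian_type (gT : finGroupType) (A : {group gT}) : abelian A ->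
  (\prod_(m <- abelian_type A) m = #|A|)%N.
Proof.
case/abelian_structure=> b defA <-.
by rewrite -(bigdprod_card defA) big_map; apply: eq_bigr.
Qed.

Lemma abelian_type_exponent (gT : finGroupType) (A : {group gT}) : abelian A -> A :!=: 1%g ->
  exists t, abelian_type A = exponent A :: t.
Proof.
move=> cAA ntA; rewrite /abelian_type -(prednK (cardG_gt0 A)) /=.
case: andP => [_|[]]; last by split; rewrite /= genGid.
by move: (abelian_type_rec _ _) => t; exists t; rewrite /= genGid.
Qed.

Section Star.
Variables (n : nat) (G : finZmodType) (F : nat -> nat -> nat -> nat -> G).
Hypotheses (n_gt2 : (2 < n)%N) (odd_n : odd n) (co : coordinates n F).

Lemma exponent_coordinates : exponent [set: G] = (2 * n)%N.
Proof.
apply/eqP; rewrite eqn_dvd; apply/andP; split.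
  apply/exponentP => x _; rewrite mulnC FinRing.zmodXgE mulrnA.
  exact: ebo_exp (coordinates_elementary n_gt2 odd_n co) x.
have := dvdn_exponent (in_setT (F 0 0 0 1)); apply: dvdn_trans.
have /eqP := expg_order (F 0 0 0 1).
by rewrite FinRing.zmodXgE (coordMn co) mul1n (coord_eq0 co) => /and4P[].
Qed.

(** The largest invariant factor is the exponent 2 n. The others have product 8
    and divide 2 n with n odd, so that each of them is 2. *)
Lemma davenport_star_coordinates : davenport_star G = n.*2.+2.
Proof.
have cGG : abelian [set: G] by apply: FinRing.zmod_abelian.
have cG : #|[set: G]| = (2 * n * 8)%N.
  by rewrite cardsT (card_coordinates n_gt2 odd_n co); lia.
have ntG : [set: G] != 1%g by rewrite -cardG_gt1 cG; lia.
have [t Et] := abelian_type_exponent cGG ntG.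
have sorted_t := abelian_type_dvdn_sorted [set: G].
have gt1_t := abelian_type_gt1 [set: G].
have := prod_abelian_type cGG.
rewrite /davenport_star Et exponent_coordinates in sorted_t gt1_t *.
rewrite !big_cons cG => /eqP; rewrite eqn_pmul2l; last by lia.
move: gt1_t => /= /andP[_ gt1_t] /eqP prod_t.
have all2 : all (pred1 2) t.
  apply/allP => m mt /=; have m1 : (1 < m)%N := seq.allP gt1_t m mt.
  have m8 : (m %| 8)%N by rewrite -prod_t (big_rem m mt) dvdn_mulr.
  have m2n : (m %| 2 * n)%N.
    have tr : transitive [rel a b | b %| a]%N by move=> a b c /= ba ac; apply: dvdn_trans ac ba.
    by move: sorted_t; rewrite /= (path_sortedE tr) => /andP[/allP/(_ m mt)].
  have : (m %| 2)%N.
    rewrite -(@Gauss_dvdl m 2 n) //.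
    apply: (coprime_dvdl m8); rewrite (_ : 8 = 2 ^ 3)%N // coprimeXl //.
    by rewrite coprime2n.
  move=> mdvd2; have m2 := dvdn_leq (isT : 0 < 2)%N mdvd2.
  by rewrite eqn_leq m2 m1.
have Et2 : t = nseq (size t) 2%N by apply/all_pred1P.
have sz_t : size t = 3%N.
  move: prod_t; rewrite Et2 big_nseq iter_muln_1 size_nseq (_ : 8 = 2 ^ 3)%N //.
  by move/eqP; rewrite eqn_exp2l // => /eqP.
by rewrite Et2 sz_t !big_cons big_nil; lia.
Qed.

End Star.

Theorem theorem1p2 (n : nat) (G : finZmodType) :
  (3 <= n)%N -> odd n ->
  [set: G] \isog [set: 'Z_2 * 'Z_2 * 'Z_2 * 'Z_(2 * n)] ->
  [/\ nu G = nu_index G 2,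
      nu_index G 2 = davenport G
    & davenport G = davenport_star G].
Proof.
move=> n_gt2 odd_n isoG; have n_gt0 : (0 < n)%N by apply: leq_trans n_gt2.
have [F co] := isog_coordinates n_gt0 isoG.
have nu_nu2 := nu_le_nu2 G.
have nu2_d := nu2_le n_gt2 odd_n co; have d_nu := nu_ge n_gt2 odd_n co.
rewrite (davenport_coordinates n_gt2 odd_n co) (davenport_star_coordinates n_gt2 odd_n co).
split=> //; apply/eqP; rewrite eqn_leq.
  by rewrite nu_nu2 (leq_trans nu2_d d_nu).
by rewrite nu2_d (leq_trans d_nu nu_nu2).
Qed.
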